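(* Let $X$ be a complex Banach space with open unit ball $\mathbb{B}$, let $\lambda,\mu\in\mathbb{C}$, $e\in\partial\mathbb{B}$, $e^*\in J(e)$. Let $f$ and $g$ be $X$-valued mappings holomorphic in a neighborhood of the origin of $X$ and represented there by the series of homogeneous polynomials $f(x)=x+\sum_{k=2}^\infty P_k(x)$ and $g(x)=x+\sum_{k=2}^\infty Q_k(x)$. Denote $N_f:=\left\|\frac12D^2f(0)\right\|$, $N_g:=\left\|\frac12D^2g(0)\right\|$, and $$R(f,g):=\Psi_e(f\circ g,\lambda,\mu)-\bigl(\Psi_e(f,\lambda,\mu)+\Psi_e(g,\lambda,\mu)\bigr).$$ Then $$\|R(f,g)\|\le\ell(\lambda,\mu)\cdot N_f\,N_g,\qquad\text{where } \ell(\lambda,\mu)=2|\lambda-\mu|+|\mu|+|\mu-2|.$$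
   Context: Notation: $X^*$ is the dual space with pairing $\langle x,a\rangle$, $J(x)=\{x^*\in X^*:\|x^*\|=\|x\|,\ \langle x,x^*\rangle=\|x\|^2\}$. $D^kf(0)$ is the $k$-th Fréchet derivative at $0$ (bounded symmetric $k$-linear operator), and $P_k(x)=\frac1{k!}D^kf(0)[x^k]$. The norm of a bounded bilinear operator $S$ is $\|S\|=\sup\{\|S[x,y]\|:\|x\|\le1,\|y\|\le1\}$. Fekete–Szegő mapping: for $f(x)=x+\sum_{k\ge2}P_k(x)$ holomorphic near $0$, $$\Psi_e(f,\lambda,\mu)=P_3(e)-\frac{\mu}{2}D^2f(0)[e,P_2(e)]-(\lambda-\mu)\langle P_2(e),e^*\rangle P_2(e).$$ *)

(* Defs.v *)
From HB Require Import structures.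
From mathcomp Require Import all_boot all_order all_algebra.
From mathcomp Require Import all_classical all_reals all_analysis.
From mathcomp Require Import complex.
Set Implicit Arguments.
Unset Strict Implicit.
Unset Printing Implicit Defensive.
Import Order.TTheory GRing.Theory Num.Theory.
Import numFieldNormedType.Exports.
Local Open Scope classical_set_scope.
Local Open Scope ring_scope.
Local Open Scope complex_scope.

(* A complex normed space is a [normedModType R[i]]; its norm takes values in
   R[i] (nonnegative reals), so [Re] is applied before taking suprema in R. *)
Section FeketeSzego.
Context {R : realType} {X : normedModType R[i]}.
Implicit Types (f : X -> X) (a e x : X) (k n : nat).

Definition multilinear n (A : n.-tuple X -> X) : Prop :=
  forall (i : 'I_n) (v : n.-tuple X),
    linear (fun x : X => A [tuple if j == i then x else tnth v j | j < n]).

Definition bounded_multilinear n (A : n.-tuple X -> X) : Prop :=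
  multilinear A /\
  exists M : R[i], forall v : n.-tuple X,
    `|A v| <= M * \prod_(i < n) `|tnth v i|.

Definition multilinear_norm n (A : n.-tuple X -> X) : R :=
  sup [set complex.Re `|A v| | v in
         [set v : n.-tuple X | forall i, `|tnth v i| <= 1]].

(* [F] is a map from X to the bounded n-linear operators with the operator
   norm. The Frechet derivative of [F] at [a], a bounded linear map from X to
   that space, is curried into the (n+1)-linear operator
   [h :: v |-> (DF(a) h)(v)]. The last clause is
   ||F(a + h) - F(a) - DF(a) h|| <= eps ||h|| for h near 0. *)
Definition is_frechet_derivative n (F : X -> n.-tuple X -> X) a
    (L : n.+1.-tuple X -> X) : Prop :=
  bounded_multilinear L /\
  forall eps : R[i], 0 < eps ->
    \forall h \near (0 : X), forall v : n.-tuple X,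
      `|F (a + h) v - F a v - L [tuple of h :: v]|
        <= eps * `|h| * \prod_(i < n) `|tnth v i|.

(* Total: the zero operator where the derivative does not exist. *)
Definition frechet_derivative n (F : X -> n.-tuple X -> X) a :
    n.+1.-tuple X -> X :=
  xget (fun=> 0) [set L | is_frechet_derivative F a L].

(* [Dn k f a [tuple v1; .. ; vk]] is D^k f(a)[v1, .. , vk]. *)
Fixpoint Dn k f : X -> k.-tuple X -> X :=
  match k with
  | 0 => fun a _ => f a
  | k'.+1 => frechet_derivative (Dn (k := k') f)
  end.

Definition taylor_poly k f x : X :=
  (k`!%:R : R[i])^-1 *: Dn (k := k) f 0 [tuple of nseq k x].

Definition holomorphic_near0 f : Prop :=
  \forall x \near (0 : X), differentiable f x.

(* f(x) = x + sum_(k >= 2) P_k(x) near 0 *)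
Definition normalized_taylor_near0 f : Prop :=
  \forall x \near (0 : X),
    (fun n => x + \sum_(2 <= k < n) taylor_poly k f x) @ \oo --> f x.

Definition open_unit_ball : set X := [set x | `|x| < 1].

Definition boundary (A : set X) : set X := closure A `\` interior A.

Definition dual_norm (u : X -> R[i]) : R :=
  sup [set complex.Re `|u x| | x in [set x : X | `|x| <= 1]].

Definition duality_set x : set {linear X -> R[i]^o} :=
  [set u | [/\ continuous (u : X -> R[i]^o),
               (dual_norm u)%:C = `|x| & u x = `|x| ^+ 2]].

Definition fekete_szego (e : X) (estar : {linear X -> R[i]^o}) f
    (lambda mu : R[i]) : X :=
  taylor_poly 3 f e
  - (mu / 2) *: Dn (k := 2) f 0 [tuple e; taylor_poly 2 f e]
  - ((lambda - mu) * estar (taylor_poly 2 f e)) *: taylor_poly 2 f e.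

(* || D^2 f(0) / 2 || *)
Definition half_D2_norm f : R :=
  multilinear_norm (fun v : 2.-tuple X => (2^-1 : R[i]) *: Dn (k := 2) f 0 v).

End FeketeSzego.

(* Main.v *)
Require Import Defs.
From HB Require Import structures.
From mathcomp Require Import all_boot all_order all_algebra.
From mathcomp Require Import all_classical all_reals all_analysis.
From mathcomp Require Import complex.
From mathcomp Require Import ring lra zify separable cyclotomic cyclic.
Import Order.TTheory GRing.Theory Num.Theory.
Import numFieldNormedType.Exports.
Set Implicit Arguments.
Unset Strict Implicit.
Unset Printing Implicit Defensive.
Local Open Scope classical_set_scope.
Local Open Scope ring_scope.
Local Open Scope complex_scope.

(* No Cauchy integral is needed: a convergent power series is a locally
   uniform limit of maps that are polynomial on every complex line, and the
   Taylor coefficients of a polynomial are finite averages over roots of unity.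
   Averaging yields Cauchy's estimates, expresses a directional derivative as a
   combination of translates (so it is again polynomial on lines, and mixed
   derivatives commute), and passes to uniform limits by completeness.  Hence
   f, g and f \o g have iterated Frechet derivatives near 0 given by iterated
   directional derivatives.  Expanding f (g (z e)) up to O(z^4) gives
     P_2(f o g) = P_2 + Q_2,  P_3(f o g) = P_3 + Q_3 + D^2 f(0)[e, Q_2],
   and after polarization the remainder R(f, g) is
     (1 - mu/2) D^2 f(0)[e, Q_2] - mu/2 D^2 g(0)[e, P_2]
       - (lambda - mu) (<P_2, e^*> Q_2 + <Q_2, e^*> P_2),
   all at the point e, which is estimated term by term. *)

(** * Polynomials on complex lines *)

(** The obstacle is the form of [Dn]: each derivative is a value selected by [xget], so every order
    needs an explicit candidate, a remainder estimate uniform over all directions, and uniqueness.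
    The class [hol] is shaped for this. Its approximants only have to obey one degree bound valid on
    all lines. A mean over roots of unity yields constants that do not see the degree, so each
    estimate survives the limit. The class is closed under directional derivatives, at the cost of a
    smaller radius, and under composition; hence one argument serves every order and all three maps.
    Origin of the constant: [D^2 f(0)[e, Q_2]] occurs once in [P_3(f o g)] and once, with factor
    [- mu / 2], in the second term of the functional. Half of it is bounded by [N_f N_g], which
    leaves the factor [|mu - 2|]. The other mixed second derivative, [D^2 g(0)[e, P_2]], occurs only
    in the second term and gives [|mu|]. The two cross terms of the quadratic expression in
    [P_2 + Q_2] give [2 |lambda - mu|]. *)

Section RealNorm.
Context {R : realType} {V : normedZmodType R[i]}.
Implicit Types x y : V.

(** The order on [R[i]] is only partial. Real-valued norms make minima, [lra] and [nra] available;
    [nrmE] translates back. *)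
Definition nrm x : R := complex.Re `|x|.

Lemma nrmE x : `|x| = (nrm x)%:C.
Proof. by rewrite /nrm RRe_real// ger0_real. Qed.

Lemma nrm_le x (r : R) : (`|x| <= r%:C) = (nrm x <= r).
Proof. by rewrite nrmE lecR. Qed.

Lemma nrm_lt x (r : R) : (`|x| < r%:C) = (nrm x < r).
Proof. by rewrite nrmE ltcR. Qed.

Lemma nrm_ge0 x : 0 <= nrm x.
Proof. by rewrite -lecR -nrmE; exact: normr_ge0. Qed.

Lemma nrmD x y : nrm (x + y) <= nrm x + nrm y.
Proof. by rewrite -lecR rmorphD /= -!nrmE ler_normD. Qed.

Lemma nrmN x : nrm (- x) = nrm x.
Proof. by rewrite /nrm normrN. Qed.

Lemma nrm_distC x y : nrm (x - y) = nrm (y - x).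
Proof. by rewrite -nrmN opprB. Qed.

Lemma nrmB x y : nrm (x - y) <= nrm x + nrm y.
Proof. by rewrite -(nrmN y) nrmD. Qed.

Lemma nrm0 : nrm (0 : V) = 0.
Proof. by rewrite /nrm normr0. Qed.

Lemma nrm0_eq0 x : nrm x = 0 -> x = 0.
Proof. by move=> x0; apply/eqP; rewrite -normr_eq0 nrmE x0. Qed.

Lemma nrm_sum (I : Type) (r : seq I) (P : pred I) (F : I -> V) :
  nrm (\sum_(i <- r | P i) F i) <= \sum_(i <- r | P i) nrm (F i).
Proof.
elim/big_ind2: _ => [|u a v b ua vb|//]; first by rewrite nrm0.
by rewrite (le_trans (nrmD _ _))// lerD.
Qed.

End RealNorm.

Section ScalarNorm.
Context {R : realType}.
Implicit Types z w : R[i].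

Lemma nrmM z w : nrm (z * w) = nrm z * nrm w.
Proof. by apply: complexI; rewrite rmorphM /= -!nrmE normrM. Qed.

Lemma nrmX z n : nrm (z ^+ n) = nrm z ^+ n.
Proof. by apply: complexI; rewrite rmorphXn /= -!nrmE normrX. Qed.

Lemma nrmC (r : R) : 0 <= r -> nrm r%:C = r.
Proof. by move=> r0; apply: complexI; rewrite -nrmE ger0_norm ?lecR. Qed.

Lemma nrm1 : nrm (1 : R[i]) = 1.
Proof. exact: nrmC. Qed.

Lemma nrmV z : nrm z^-1 = (nrm z)^-1.
Proof. by apply: complexI; rewrite fmorphV /= -!nrmE normfV. Qed.

Lemma nrm_nat n : nrm (n%:R : R[i]) = n%:R.
Proof. by rewrite -(rmorph_nat (@real_complex R)) nrmC. Qed.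

Lemma nrmZ (X : normedModType R[i]) z (x : X) : nrm (z *: x) = nrm z * nrm x.
Proof. by apply: complexI; rewrite rmorphM /= -!nrmE normrZ. Qed.

End ScalarNorm.

Section LinePolynomials.
Context {R : realType} {X : normedModType R[i]}.
Local Notation C := R[i].
Implicit Types (phi psi : C -> X) (S : X -> X) (a h v x : X).

(** ['X^N - 1] splits over the algebraically closed field [R[i]] and is separable in characteristic
    0. A field with [N] distinct [N]-th roots of unity contains a primitive one. *)
Lemma primitive_root_exists N : (0 < N)%N ->
  exists w : C, N.-primitive_root w.
Proof.
move=> N0; have nz : N%:R != 0 :> C by rewrite pnatr_eq0 -lt0n.
pose p : {poly C} := 'X^N - 1.
have [r Dp] := closed_field_poly_normal p.
have lp : lead_coef p = 1 by rewrite (eqP (monicXnsubC 1 N0)).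
rewrite lp scale1r in Dp.
have sr : size r = N.
  apply: succn_inj; rewrite -(size_prod_XsubC _ id) -Dp /p.
  exact: size_XnsubC.
have /hasP[w _ pw] : has N.-primitive_root r.
  apply: has_prim_root; rewrite ?sr//.
    apply/allP => z zr; rewrite unity_rootE -subr_eq0.
    have : root p z by rewrite Dp root_prod_XsubC.
    by rewrite /root /p !hornerE.
  by rewrite -separable_prod_XsubC -Dp separable_Xn_sub_1.
by exists w.
Qed.

(** The value 1 at [N = 0] keeps the modulus equal to 1 for every [N]. *)
Definition unity_gen N : C :=
  if N is M.+1 then xchoose (primitive_root_exists (ltn0Sn M)) else 1.

Lemma unity_genP N : (0 < N)%N -> N.-primitive_root (unity_gen N).
Proof. by case: N => // N _; exact: (xchooseP (primitive_root_exists _)). Qed.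

Lemma nrm_unity_gen N : nrm (unity_gen N) = 1.
Proof.
case: N => [|N]; first exact: nrm1.
apply/eqP; rewrite -(@pexpr_eq1 _ _ N.+1)// ?nrm_ge0// -nrmX.
by rewrite (prim_expr_order (unity_genP _))// nrm1.
Qed.

Lemma sum_unity_gen N m : (0 < N)%N ->
  \sum_(i < N) (unity_gen N ^+ m) ^+ i = if (N %| m)%N then N%:R else 0.
Proof.
move=> N0; have pw := unity_genP N0.
rewrite (prim_order_dvd pw); case: eqP => [->|/eqP wm].
  by under eq_bigr do rewrite expr1n; rewrite sumr_const card_ord.
apply: (mulfI (_ : unity_gen N ^+ m - 1 != 0)); first by rewrite subr_eq0.
by rewrite -subrX1 mulr0 exprAC (prim_expr_order pw) expr1n subrr.
Qed.

Definition vpoly N phi := exists c : nat -> X,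
  forall z, phi z = \sum_(j < N) z ^+ j *: c j.

Lemma vpoly_widen M N phi : (M <= N)%N -> vpoly M phi -> vpoly N phi.
Proof.
move=> MN [c cE]; exists (fun j => if (j < M)%N then c j else 0) => z.
rewrite cE (big_ord_widen N (fun j => z ^+ j *: c j))// big_mkcond.
by apply: eq_bigr => j _; case: ifP; rewrite ?scaler0.
Qed.

Lemma vpolyD N phi psi : vpoly N phi -> vpoly N psi ->
  vpoly N (fun z => phi z + psi z).
Proof.
move=> [c cE] [d dE]; exists (fun j => c j + d j) => z.
by rewrite cE dE -big_split; apply: eq_bigr => j _; rewrite scalerDr.
Qed.

Lemma vpolyZ N k phi : vpoly N phi -> vpoly N (fun z => k *: phi z).
Proof.
move=> [c cE]; exists (fun j => k *: c j) => z.
by rewrite cE scaler_sumr; apply: eq_bigr => j _; rewrite !scalerA mulrC.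
Qed.

Lemma vpoly_sum N I (r : seq I) (phi : I -> C -> X) :
  (forall i, vpoly N (phi i)) -> vpoly N (fun z => \sum_(i <- r) phi i z).
Proof.
move=> phiP; elim: r => [|i r IH].
  by exists (fun=> 0) => z; rewrite big_nil big1// => j _; rewrite scaler0.
have [c cE] := vpolyD (phiP i) IH.
by exists c => z; rewrite big_cons cE.
Qed.

Lemma vpolyM N k phi : vpoly N phi -> vpoly (k + N) (fun z => z ^+ k *: phi z).
Proof.
move=> [c cE]; exists (fun j => if (k <= j)%N then c (j - k)%N else 0) => z.
rewrite cE big_split_ord/= [X in _ = X + _]big1 ?add0r => [|j _]; last first.
  by rewrite leqNgt ltn_ord/= scaler0.
rewrite scaler_sumr; apply: eq_bigr => j _.
by rewrite leq_addr addKn exprD scalerA.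
Qed.

(** Inversion of the discrete Fourier transform on [N] points; the exponent [N - k] stands for
    [- k]. *)
Lemma coef_extract N phi (c : nat -> X) k (r : C) : (k < N)%N ->
  (forall z, phi z = \sum_(j < N) z ^+ j *: c j) ->
  r ^+ k *: c k = N%:R^-1 *:
    \sum_(i < N) (unity_gen N ^+ (N - k)) ^+ i *: phi (r * unity_gen N ^+ i).
Proof.
move=> kN phiE; have N0 : (0 < N)%N by apply: leq_ltn_trans kN.
under eq_bigr do rewrite phiE scaler_sumr.
rewrite exchange_big/=.
have E (j : 'I_N) : \sum_(i < N) (unity_gen N ^+ (N - k)) ^+ i *:
    ((r * unity_gen N ^+ i) ^+ j *: c j) =
    if j == Ordinal kN then N%:R *: (r ^+ k *: c k) else 0.
  rewrite (eq_bigr (fun i : 'I_N =>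
      (unity_gen N ^+ (N - k + j)) ^+ i *: (r ^+ j *: c j))); last first.
    move=> i _; rewrite !scalerA exprMn mulrCA mulrC -mulrA; congr (_ *: _).
    by rewrite mulrA; congr (_ * _); rewrite -!exprM -exprD mulnDl (mulnC i).
  rewrite -scaler_suml sum_unity_gen//.
  (* Since [0 < N - k + j < 2 * N], the only possible multiple of [N] is [N] itself, which means
     [j = k]. *)
  have -> : (N %| N - k + j)%N = (j == Ordinal kN).
    rewrite -val_eqE/=; apply/idP/eqP => [|->]; last by rewrite subnK// ltnW.
    have jN := ltn_ord j; move=> /dvdnP[[|[|q]]]; rewrite ?mulSn; lia.
  by case: eqP => [->//|_]; rewrite scale0r.
rewrite (eq_bigr _ (fun j _ => E j)) -big_mkcond big_pred1_eq.
by rewrite scalerK// pnatr_eq0 -lt0n.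
Qed.

(** Cauchy's estimate: by [coef_extract] the term is a mean of [N] values of [phi], each times a
    number of modulus 1. The bound is free of [N], which later allows limits of growing degree. *)
Lemma coef_bound N phi (c : nat -> X) k (r M : R) : (k < N)%N -> 0 <= r ->
  (forall z, phi z = \sum_(j < N) z ^+ j *: c j) ->
  (forall z, nrm z = r -> nrm (phi z) <= M) ->
  r ^+ k * nrm (c k) <= M.
Proof.
move=> kN r0 phiE phiM; have N0 : (0 < N)%N by apply: leq_ltn_trans kN.
have -> : r ^+ k * nrm (c k) = nrm (r%:C ^+ k *: c k).
  by rewrite nrmZ nrmX nrmC.
rewrite (coef_extract _ kN phiE) nrmZ nrmV nrm_nat.
rewrite ler_pdivrMl ?ltr0n// (le_trans (nrm_sum _ _ _))//.
rewrite (le_trans (ler_sum _ (_ : forall i, true -> _ <= M))) => [//|i _|].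
  rewrite nrmZ !nrmX nrm_unity_gen !expr1n mul1r phiM// nrmM nrmX.
  by rewrite nrm_unity_gen expr1n mulr1 nrmC.
by rewrite sumr_const card_ord mulr_natl.
Qed.

(** One [N] serves all lines. No continuity is imposed: bounds will come from closeness to a bounded
    map. *)
Definition line_poly N S := forall a h, vpoly N (fun z => S (a + z *: h)).

Lemma line_poly_widen M N S : (M <= N)%N -> line_poly M S -> line_poly N S.
Proof. by move=> MN SP a h; exact: vpoly_widen (SP a h). Qed.

Lemma line_polyZD N k S T : line_poly N S -> line_poly N T ->
  line_poly N (fun x => k *: S x + T x).
Proof. by move=> SP TP a h; exact: vpolyD (vpolyZ _ (SP a h)) (TP a h). Qed.

End LinePolynomials.

(** * Directional derivatives and composition of line polynomials *)

Section LinePolynomialDerivatives.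
Context {R : realType} {X : normedModType R[i]}.
Local Notation C := R[i].
Implicit Types (phi psi : C -> X) (F S T : X -> X) (a h v x : X).

(** The directional derivative is a total [lim]; a quadratic remainder on some disc proves
    convergence and identifies the limit at once. *)
Lemma derive_quadratic F a v L (e K : R) : 0 < e ->
  (forall z : C, nrm z <= e ->
     nrm (F (a + z *: v) - F a - z *: L) <= K * nrm z ^+ 2) ->
  'D_v F a = L.
Proof.
move=> e0 FL; apply: cvg_lim => //; apply/cvgrPdist_le => d d0.
have dE : d = (complex.Re d)%:C by rewrite RRe_real// gtr0_real.
set d' := complex.Re d in dE; have d'0 : 0 < d' by rewrite -ltcR -dE.
(* For [nrm z <= m] the difference quotient is off by at most [K * nrm z <= d']; [|K| + 1] takes
   care of [K <= 0]. *)
pose m := Num.min e (d' / (`|K| + 1)).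
have K1 : 0 < `|K| + 1 by rewrite ltr_wpDl.
have m0 : 0 < m%:C :> C by rewrite ltcR lt_min e0 divr_gt0.
near=> z; have z0 : z != 0 by near: z; exact: nbhs_dnbhs_neq.
have zm : nrm z <= m by rewrite -nrm_le; near: z; exact: dnbhs0_le.
have [ze zd] : nrm z <= e /\ nrm z <= d' / (`|K| + 1).
  by apply/andP; rewrite -le_min.
rewrite dE nrm_le nrm_distC /= (addrC (z *: v)).
rewrite -[X in _ - X](scalerK z0) -scalerBr nrmZ nrmV.
have nz : 0 < nrm z by rewrite -ltcR -nrmE normr_gt0.
rewrite ler_pdivrMl// (le_trans (FL _ ze))// mulrC expr2 -mulrA ler_pM2l//.
rewrite (le_trans (ler_norm _))// normrM (ger0_norm (nrm_ge0 _)) mulrC.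
rewrite (le_trans (ler_wpM2l (normr_ge0 K) zd))//.
by rewrite mulrCA ger_pMr// ler_pdivrMr// mul1r lerDl.
Unshelve. all: by end_near. Qed.

Lemma geometric_tail (q : R) m n : 0 <= q < 1 ->
  \sum_(m <= j < n) q ^+ j <= q ^+ m / (1 - q).
Proof.
move=> /andP[q0 q1]; have q1' : 0 < 1 - q by rewrite subr_gt0.
have [mn|nm] := leqP m n; last first.
  by rewrite big_geq ?(ltnW nm)// divr_ge0 ?exprn_ge0// ltW.
suff : \sum_(m <= j < n) q ^+ j + q ^+ n / (1 - q) <= q ^+ m / (1 - q).
  by apply: le_trans; rewrite lerDl divr_ge0 ?exprn_ge0// ltW.
rewrite -(subnKC mn); elim: (n - m)%N => [|k IH].
  by rewrite addn0 big_geq// add0r.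
rewrite addnS big_nat_recr ?leq_addr//=.
apply: le_trans IH; rewrite -addrA lerD2l le_eqVlt; apply/orP; left; apply/eqP.
by rewrite exprS; field; rewrite gt_eqF.
Qed.

(** By [coef_bound] the tail is dominated by a geometric series of ratio [nrm z / r <= 1/2], whence
    the factor 2. Again [N] does not enter. *)
Lemma coef_tail N phi (c : nat -> X) k (r M : R) z : (k < N)%N -> 0 < r ->
  (forall z, phi z = \sum_(j < N) z ^+ j *: c j) ->
  (forall z, nrm z = r -> nrm (phi z) <= M) -> nrm z <= r / 2 ->
  nrm (phi z - \sum_(j < k) z ^+ j *: c j) <= 2 * M * (nrm z / r) ^+ k.
Proof.
move=> kN r0 phiE phiM zr.
have cM j : (j < N)%N -> nrm (c j) <= M / r ^+ j.
  move=> jN; rewrite ler_pdivlMr ?exprn_gt0// mulrC.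
  exact: coef_bound (ltW r0) phiE phiM.
have M0 : 0 <= M.
  have := cM 0%N (leq_ltn_trans (leq0n k) kN).
  by rewrite expr0 divr1; apply: le_trans (nrm_ge0 _).
rewrite phiE -!(big_mkord predT (fun j => z ^+ j *: c j)).
rewrite (big_cat_nat _ (ltnW kN))//= addrAC subrr add0r.
rewrite (le_trans (nrm_sum _ _ _))// (mulrC 2) -mulrA.
have q : 0 <= nrm z / r <= 2^-1.
  by rewrite divr_ge0 ?nrm_ge0 ?(ltW r0)//= ler_pdivrMr// mulrC.
apply: (@le_trans _ _ (M * \sum_(k <= j < N) (nrm z / r) ^+ j)); last first.
  have [q0 q2] := andP q; rewrite ler_wpM2l//.
  have q01 : 0 <= nrm z / r < 1 by rewrite q0 (le_lt_trans q2)// invf_lt1// ltr1n.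
  rewrite (le_trans (geometric_tail k N q01))// mulrC ler_wpM2r ?exprn_ge0//.
  by rewrite -[leRHS]invrK lef_pV2 ?posrE ?invr_gt0//; lra.
rewrite mulr_sumr big_nat_cond [leRHS]big_nat_cond; apply: ler_sum => j.
rewrite andbT => /andP[_ jN]; rewrite nrmZ nrmX expr_div_n mulrCA.
by rewrite ler_wpM2l ?exprn_ge0 ?nrm_ge0// cM.
Qed.

Lemma derive_vpoly N S a v (c : nat -> X) : (1 < N)%N ->
  (forall z, S (a + z *: v) = \sum_(j < N) z ^+ j *: c j) -> 'D_v S a = c 1%N.
Proof.
move=> N1 SE; pose M : R := \sum_(j < N) nrm (c j).
(* [coef_tail] at [k = 2] asks for [2 < N]; when [N = 2] the map is affine on the line and the
   remainder is 0. *)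
have [N2|] := ltnP 2 N; last first.
  move=> N2; have {N1 N2}EN : N = 2%N by lia.
  apply: (@derive_quadratic _ _ _ _ 1 0) => // z _.
  rewrite -[X in _ - S X - _]addr0 -[X in _ - S (_ + X) - _](scale0r v) !SE EN.
  rewrite !big_ord_recl !big_ord0 /= /bump /= !expr0 !expr1 !scale0r !addr0.
  by rewrite addn0 addrAC addrK subrr nrm0 mul0r.
have SM z : nrm z = 1 -> nrm (S (a + z *: v)) <= M.
  move=> z1; rewrite SE (le_trans (nrm_sum _ _ _))//; apply: ler_sum => j _.
  by rewrite nrmZ nrmX z1 expr1n mul1r.
apply: (@derive_quadratic _ _ _ _ (1 / 2) (2 * M)) => // z z1.
have := coef_tail N2 ltr01 SE SM z1.
rewrite divr1 !big_ord_recl big_ord0 /bump /= expr0 scale1r expr1 addr0.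
have -> : c 0%N = S a.
  rewrite -[in RHS](addr0 a) -(scale0r v) SE; case: N N1 {SE M N2 SM} => // N _.
  rewrite big_ord_recl/= expr0 scale1r big1 ?addr0// => j _.
  by rewrite exprS mul0r scale0r.
by rewrite opprD addrA.
Qed.

(** The guard [1 < N] matters: for smaller [N] the value [c 1] is unconstrained. *)
Lemma line_poly_vexp N S a v : line_poly N S -> exists2 c : nat -> X,
  (forall z, S (a + z *: v) = \sum_(j < N) z ^+ j *: c j)
  & (1 < N)%N -> 'D_v S a = c 1%N.
Proof.
move=> SP; have [c cE] := SP a v; exists c => // N1.
exact: derive_vpoly N1 cE.
Qed.

(** The derivative is the coefficient of [z], extracted with [r = 1]. A fixed finite combination of
    translates of [S] inherits whatever is stable under translation and linear combination. *)
Lemma derive_line_poly N S a v : (1 < N)%N -> line_poly N S ->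
  'D_v S a = N%:R^-1 *: \sum_(i < N)
     (unity_gen N ^+ (N - 1)) ^+ i *: S (a + unity_gen N ^+ i *: v).
Proof.
move=> N1 SP; have [c cE ->//] := line_poly_vexp a v SP.
rewrite -[LHS]scale1r -(expr1 1) (coef_extract 1 N1 cE); congr (_ *: _).
by apply: eq_bigr => i _; rewrite mul1r.
Qed.

Lemma line_poly_shift N S b : line_poly N S -> line_poly N (fun x => S (x + b)).
Proof.
move=> SP a h; have [c cE] := SP (a + b) h.
by exists c => z; rewrite addrAC cE.
Qed.

Lemma line_poly_derive N S v : (1 < N)%N -> line_poly N S ->
  line_poly N (fun x => 'D_v S x).
Proof.
move=> N1 SP a h.
have [|c cE] := @vpolyZ _ _ N (N%:R^-1) (fun z => \sum_(i < N)
  (unity_gen N ^+ (N - 1)) ^+ i *: S (a + z *: h + unity_gen N ^+ i *: v)).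
  by apply: vpoly_sum => i; apply: vpolyZ; exact: line_poly_shift.
by exists c => z; rewrite -cE -derive_line_poly.
Qed.

(** Translations along [h] and [v] commute, so this is an exchange of two finite sums. *)
Lemma derive_line_polyC N S a h v : (1 < N)%N -> line_poly N S ->
  'D_v (fun x => 'D_h S x) a = 'D_h (fun x => 'D_v S x) a.
Proof.
move=> N1 SP; rewrite !(@derive_line_poly N _ _ _ N1); try exact: line_poly_derive.
congr (_ *: _).
under eq_bigr do
  rewrite (derive_line_poly _ _ N1 SP) scalerA mulrC -scalerA scaler_sumr.
rewrite -scaler_sumr exchange_big/=.
under [in RHS]eq_bigr do
  rewrite (derive_line_poly _ _ N1 SP) scalerA mulrC -scalerA scaler_sumr.
rewrite -scaler_sumr; congr (_ *: _); apply: eq_bigr => i _; apply: eq_bigr => j _.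
by rewrite !scalerA mulrC addrAC.
Qed.

(** Lines are replaced by curves of degree below [m]. [B] is chosen before [S], so that the
    induction hypothesis applies to [D k], the [k]-th coefficient of [S] in the direction [c m];
    putting [z ^+ m] for the parameter adds at most [m * N] to the degree. *)
Lemma line_poly_vpoly N m : exists B, forall S (c : nat -> X), line_poly N S ->
  vpoly B (fun z => S (\sum_(i < m) z ^+ i *: c i)).
Proof.
elim: m => [|m [B IH]].
  exists 1%N => S c _; exists (fun=> S 0) => z.
  by rewrite big_ord0 big_ord1 expr0 scale1r.
exists (m * N + B)%N => S c SP.
pose D k y := N%:R^-1 *: \sum_(i < N) (unity_gen N ^+ (N - k)) ^+ i *:
  S (y + unity_gen N ^+ i *: c m).
have SD y z : S (y + z *: c m) = \sum_(k < N) z ^+ k *: D k y.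
  have [d dE] := SP y (c m); rewrite dE; apply: eq_bigr => k _; congr (_ *: _).
  rewrite -[LHS]scale1r -(expr1n _ k) (coef_extract 1 (ltn_ord k) dE).
  by congr (_ *: _); apply: eq_bigr => i _; rewrite mul1r.
have DP k : line_poly N (D k).
  move=> a h; apply: vpolyZ; apply: vpoly_sum => i; apply: vpolyZ.
  exact: line_poly_shift.
have [|d dE] := @vpoly_sum _ _ (m * N + B) 'I_N (index_enum _)
    (fun k z => z ^+ (m * k) *: D k (\sum_(i < m) z ^+ i *: c i)).
  move=> k; apply: vpoly_widen (vpolyM _ (IH _ c (DP k))).
  by rewrite leq_add2r leq_mul2l ltnW ?orbT.
exists d => z; rewrite -dE big_ord_recr/= SD.
by apply: eq_bigr => k _; rewrite exprM.
Qed.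

Lemma line_poly_comp M N S T : line_poly N S -> line_poly M T ->
  exists K, line_poly K (S \o T).
Proof.
move=> SP TP; have [B BP] := line_poly_vpoly N M; exists B => a h.
have [c cE] := TP a h; have [d dE] := BP S c SP.
by exists d => z; rewrite -dE/= cE.
Qed.

End LinePolynomialDerivatives.

(** * Uniform limits of line polynomials *)

Section UniformLimits.
Context {R : realType} {X : completeNormedModType R[i]}.
Local Notation C := R[i].
Implicit Types (F G S T : X -> X) (a h v w x y : X) (rho M d e r : R).

Lemma le_of_eps (s t K : R) : (forall e, 0 < e -> s <= t + e * K) -> s <= t.
Proof.
move=> H; apply/ler_addgt0Pr => e e0.
have K1 : 0 < `|K| + 1 by rewrite ltr_wpDl.
apply: le_trans (H (e / (`|K| + 1)) (divr_gt0 e0 K1)) _; rewrite lerD2l.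
rewrite mulrAC ler_pdivrMr// ler_wpM2l ?(ltW e0)//.
by rewrite (le_trans (ler_norm K))// lerDl.
Qed.

Lemma derive_dir0 F a : 'D_(0 : X) F a = 0.
Proof.
apply: (@derive_quadratic _ _ _ _ _ _ 1 0) => // z _.
by rewrite !scaler0 addr0 !subrr nrm0 mul0r.
Qed.

(** Completeness of [X] enters here; the rate of convergence is kept because the limit of
    derivatives needs an explicit error. *)
Lemma cauchy_harmonic (u : nat -> X) (K : R) :
  (forall m n, nrm (u m - u n) <= K * (m.+1%:R^-1 + n.+1%:R^-1)) ->
  exists L, forall n, nrm (u n - L) <= K * n.+1%:R^-1.
Proof.
move=> uK.
have K0 : 0 <= K.
  have := le_trans (nrm_ge0 _) (uK 0%N 0%N).
  by rewrite pmulr_lge0// addr_gt0// invr_gt0.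
have small e : 0 < e -> exists n, K * n.+1%:R^-1 < e.
  move=> e0; exists (Num.truncn (K / e)).
  rewrite ltr_pdivrMr ?ltr0n// mulrC -ltr_pdivrMr//.
  by rewrite truncnS_gt.
have mono m n : (m <= n)%N -> K * n.+1%:R^-1 <= K * m.+1%:R^-1.
  by move=> mn; rewrite ler_wpM2l// lef_pV2 ?posrE ?ltr0n// ler_nat.
have /cvg_ex[L uL] : cvgn u.
  apply/cauchy_cvgP/cauchy_exP => e e0.
  have eE : e = (complex.Re e)%:C by rewrite RRe_real// gtr0_real.
  have e'0 : 0 < complex.Re e by rewrite -ltcR -eE.
  have [n nK] := small _ (divr_gt0 e'0 (ltr0n _ 2)).
  exists (u n); exists n => // m /= nm.
  rewrite -ball_normE /ball_/= eE nrm_lt (le_lt_trans (uK _ _))//.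
  rewrite mulrDr (le_lt_trans (lerD (lexx _) (mono _ _ nm)))//.
  by rewrite [ltRHS]splitr ltrD.
exists L => n; apply: (@le_of_eps _ _ 1) => e e0; rewrite mulr1.
have e20 : 0 < e / 2 by rewrite divr_gt0.
have [m mK] := small _ e20.
have /cvgrPdist_le/(_ (e / 2)%:C)[|p _ up] := uL; first by rewrite ltcR.
have := up (maxn p m) (leq_maxl _ _).
rewrite /= nrm_le nrm_distC => uq.
rewrite -(subrKA (u (maxn p m))) (le_trans (nrmD _ _))//.
have := uK n (maxn p m); have := mono _ _ (leq_maxr p m); move: mK uq.
rewrite mulrDr; move: (K / _) (K / _) (K / _) (nrm _) (nrm _) => *; lra.
Qed.

(* Replaces holomorphy: uniform limits, on the ball of radius rho, of maps that
   are polynomial on every complex line, with a bound M on that ball. *)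
Definition hol rho M F := (forall x, nrm x < rho -> nrm (F x) <= M) /\
  forall e, 0 < e -> exists N S,
    line_poly N S /\ forall x, nrm x < rho -> nrm (S x - F x) <= e.

(** Raising the degree bound above [n] meets guards such as [1 < N] and [2 < N] in the lemmas on
    line polynomials. *)
Lemma hol_approx rho M F e n : hol rho M F -> 0 < e -> exists N S,
  [/\ (n < N)%N, line_poly N S, forall x, nrm x < rho -> nrm (S x - F x) <= e
    & forall x, nrm x < rho -> nrm (S x) <= M + e].
Proof.
move=> [FM FS] e0; have [N [S [SP SF]]] := FS e e0.
exists (maxn N n.+1), S; split=> //; first by rewrite leq_maxr.
  by apply: line_poly_widen SP; rewrite leq_maxl.
move=> x xr; rewrite -(subrK (F x) (S x)) addrC.
by rewrite (le_trans (nrmD _ _))// lerD// ?FM ?SF.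
Qed.

Lemma ball_shift rho d a (y : X) : nrm a < rho - d -> nrm y <= d ->
  nrm (a + y) < rho.
Proof. by move=> ar yd; rewrite (le_lt_trans (nrmD _ _))//; lra. Qed.

(** Cauchy's estimate on the circle of radius [d / nrm v], along which [a + z *: v] stays in the
    ball of radius [rho]. *)
Lemma line_poly_cauchy N S rho M d a v : (1 < N)%N -> line_poly N S ->
  (forall x, nrm x < rho -> nrm (S x) <= M) -> 0 < d -> nrm a < rho - d ->
  nrm ('D_v S a) <= M / d * nrm v.
Proof.
move=> N1 SP SM d0 ar.
have [->|v0] := eqVneq v 0; first by rewrite derive_dir0 nrm0 mulr0.
have nv : 0 < nrm v.
  by rewrite lt_neqAle nrm_ge0 andbT eq_sym; apply: contra_neq v0; exact: nrm0_eq0.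
have [c cE ->//] := line_poly_vexp a v SP.
have r0 : 0 < d / nrm v by rewrite divr_gt0.
have SrM (z : C) : nrm z = d / nrm v -> nrm (S (a + z *: v)) <= M.
  move=> zE; apply: SM; apply: ball_shift ar _.
  by rewrite nrmZ zE divfK// gt_eqF.
have := coef_bound N1 (ltW r0) cE SrM.
rewrite expr1 mulrAC ler_pdivrMr// => H.
by rewrite mulrAC ler_pdivlMr// mulrC.
Qed.

Lemma line_poly_quadratic N S rho M d a v r z : (2 < N)%N -> line_poly N S ->
  (forall x, nrm x < rho -> nrm (S x) <= M) -> 0 < d -> nrm a < rho - d ->
  0 < r -> r * nrm v <= d -> nrm z <= r / 2 ->
  nrm (S (a + z *: v) - S a - z *: 'D_v S a) <= 2 * M * (nrm z / r) ^+ 2.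
Proof.
move=> N2 SP SM d0 ar r0 rv zr.
have [c cE ->//] := line_poly_vexp a v SP; last exact: ltnW.
have SrM (t : C) : nrm t = r -> nrm (S (a + t *: v)) <= M.
  by move=> tE; apply: SM; apply: ball_shift ar _; rewrite nrmZ tE.
have := coef_tail N2 r0 cE SrM zr.
rewrite !big_ord_recl big_ord0 /bump /= expr0 scale1r expr1 addr0 opprD addrA.
suff -> : c 0%N = S a by [].
rewrite -[in RHS](addr0 a) -(scale0r v) cE; case: N N2 {SP cE} => // N _.
rewrite big_ord_recl/= expr0 scale1r big1 ?addr0// => j _.
by rewrite exprS mul0r scale0r.
Qed.

Lemma derive_line_polyB N N' S T a v : (1 < N)%N -> line_poly N S ->
  line_poly N' T -> 'D_v (fun x => -1 *: T x + S x) a = 'D_v S a - 'D_v T a.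
Proof.
move=> N1 SP TP; set K := maxn N N'.
have K1 : (1 < K)%N by rewrite leq_max N1.
have {}SP := line_poly_widen (leq_maxl N N') SP.
have {}TP := line_poly_widen (leq_maxr N N') TP.
have [c cE ->//] := line_poly_vexp a v SP.
have [b bE ->//] := line_poly_vexp a v TP.
rewrite (@derive_vpoly _ _ K _ _ _ (fun j => -1 *: b j + c j))//.
  by rewrite scaleN1r addrC.
move=> z; rewrite cE bE scaler_sumr -big_split; apply: eq_bigr => j _ /=.
by rewrite scalerDr !scalerA mulrC.
Qed.

(** The difference of two approximants is a line polynomial bounded by [e + e'], so Cauchy's
    estimate makes their derivatives converge. That [L] is the derivative of [F] follows only from
    the quadratic estimate. *)
Lemma hol_derive_lim rho M F d a v : hol rho M F -> 0 < d -> nrm a < rho - d ->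
  exists L, forall e N S, (1 < N)%N -> line_poly N S ->
    (forall x, nrm x < rho -> nrm (S x - F x) <= e) ->
    nrm ('D_v S a - L) <= e / d * nrm v.
Proof.
move=> FH d0 ar.
have n0 n : 0 < (n.+1%:R : R)^-1 by rewrite invr_gt0.
have /choice[SN SNP] : forall n, exists NS : nat * (X -> X),
    [/\ (1 < NS.1)%N, line_poly NS.1 NS.2 & forall x, nrm x < rho ->
       nrm (NS.2 x - F x) <= n.+1%:R^-1].
  by move=> n; have [N [S [N1 SP SF _]]] := hol_approx 1 FH (n0 n); exists (N, S).
have close e e' N N' S T : (1 < N)%N -> line_poly N S -> line_poly N' T ->
    (forall x, nrm x < rho -> nrm (S x - F x) <= e) ->
    (forall x, nrm x < rho -> nrm (T x - F x) <= e') ->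
    nrm ('D_v S a - 'D_v T a) <= (e + e') / d * nrm v.
  move=> N1 SP TP SF TF; rewrite -(derive_line_polyB _ _ N1 SP TP).
  have N1' : (1 < maxn N N')%N by rewrite leq_max N1.
  apply: (line_poly_cauchy v N1' _ _ d0 ar).
    apply: line_polyZD; [exact: line_poly_widen (leq_maxr _ _) TP|].
    exact: line_poly_widen (leq_maxl _ _) SP.
  move=> x xr; rewrite scaleN1r addrC -(subrKA (F x)) (le_trans (nrmD _ _))//.
  by rewrite lerD ?SF// nrm_distC TF.
have [L LP] : exists L, forall n,
    nrm ('D_v (SN n).2 a - L) <= nrm v / d * n.+1%:R^-1.
  apply: cauchy_harmonic => m n.
  have [m1 mP mF] := SNP m; have [_ nP nF] := SNP n.
  by rewrite mulrAC (mulrC (nrm v)) mulrAC; exact: close m1 mP nP mF nF.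
exists L => e N S N1 SP SF; apply: (@le_of_eps _ _ (2 * (nrm v / d))) => t t0.
have [n nt] : exists n, n.+1%:R^-1 < t.
  by exists (Num.truncn t^-1); rewrite invf_plt ?posrE ?ltr0n// truncnS_gt.
have [n1 nP nF] := SNP n.
rewrite -(subrKA ('D_v (SN n).2 a)) (le_trans (nrmD _ _))//.
have := close _ _ _ _ _ _ N1 SP nP SF nF; have := LP n.
have vd : 0 <= nrm v / d by rewrite divr_ge0 ?nrm_ge0 ?ltW.
have -> : (e + n.+1%:R^-1) / d * nrm v = e / d * nrm v + nrm v / d * n.+1%:R^-1.
  by ring.
have : nrm v / d * n.+1%:R^-1 <= nrm v / d * t by rewrite ler_wpM2l// ltW.
by move: (nrm v / d * n.+1%:R^-1) => q; nra.
Qed.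

Lemma hol_quadratic_lim rho M F d a v L : hol rho M F -> 0 < d ->
  nrm a < rho - d ->
  (forall e N S, (1 < N)%N -> line_poly N S ->
    (forall x, nrm x < rho -> nrm (S x - F x) <= e) ->
    nrm ('D_v S a - L) <= e / d * nrm v) ->
  forall r z, 0 < r -> r * nrm v <= d -> nrm z <= r / 2 ->
  nrm (F (a + z *: v) - F a - z *: L) <= 2 * M * (nrm z / r) ^+ 2.
Proof.
move=> FH d0 ar LP r z r0 rv zr.
(* Costs of passing from [S] to [F], in units of [e]: 2 for the two values, [nrm z * (nrm v / d)]
   for the derivative, and the last summand because [S] is bounded by [M + e] instead of [M]. *)
apply: (@le_of_eps _ _ (2 + nrm z * (nrm v / d) + 2 * (nrm z / r) ^+ 2)) => e e0.
have [N [S [N2 SP SF SM]]] := hol_approx 2 FH e0.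
have N1 := ltnW N2.
have H1 := line_poly_quadratic N2 SP SM d0 ar r0 rv zr.
have H2 := LP e N S N1 SP SF.
have az : nrm (a + z *: v) < rho.
  apply: ball_shift ar _; rewrite nrmZ (le_trans _ rv)// ler_wpM2r ?nrm_ge0//.
  by rewrite (le_trans zr)//; lra.
have H3 := SF _ az.
have H4 : nrm (S a - F a) <= e by apply: SF; lra.
have -> : F (a + z *: v) - F a - z *: L =
    (S (a + z *: v) - S a - z *: 'D_v S a)
    + ((S a - F a) - (S (a + z *: v) - F (a + z *: v)) + z *: ('D_v S a - L)).
  rewrite scalerBr.
  rewrite !opprB !addrA [RHS](ACl (1*7*2*4*3*8*6*5*9))%AC/=.
  by rewrite subrr sub0r addNr sub0r addNr add0r.
apply: le_trans (nrmD _ _) _.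
have := nrmD (S a - F a - (S (a + z *: v) - F (a + z *: v))) (z *: ('D_v S a - L)).
have := nrmB (S a - F a) (S (a + z *: v) - F (a + z *: v)).
have : nrm (z *: ('D_v S a - L)) <= nrm z * (e / d * nrm v).
  by rewrite nrmZ ler_wpM2l ?nrm_ge0.
have -> : nrm z * (e / d * nrm v) = e * (nrm z * (nrm v / d)) by ring.
move: H1 H3 H4; move: (nrm z * (nrm v / d)) ((nrm z / r) ^+ 2).
by move: (nrm _) (nrm _) (nrm _) (nrm _) (nrm _) (nrm _) => *; lra.
Qed.

Section Derivative.
Variables (rho M d : R) (F : X -> X).
Hypotheses (FH : hol rho M F) (d0 : 0 < d).

Lemma hol_quadratic_derive a v L : nrm a < rho - d ->
  (forall r z, 0 < r -> r * nrm v <= d -> nrm z <= r / 2 ->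
    nrm (F (a + z *: v) - F a - z *: L) <= 2 * M * (nrm z / r) ^+ 2) ->
  'D_v F a = L.
Proof.
move=> ar H; have v1 : 0 < nrm v + 1 by rewrite ltr_wpDl ?nrm_ge0.
pose r := d / (nrm v + 1); have r0 : 0 < r by rewrite divr_gt0.
apply: (@derive_quadratic _ _ _ _ _ _ (r / 2) (2 * M / r ^+ 2)) => [|z zr].
  by rewrite divr_gt0.
rewrite mulrAC -mulrA -expr_div_n; apply: H => //.
by rewrite /r mulrAC ler_pdivrMr// ler_wpM2l ?(ltW d0)// lerDl.
Qed.

Lemma hol_derive_approx a v e N S : nrm a < rho - d -> (1 < N)%N ->
  line_poly N S -> (forall x, nrm x < rho -> nrm (S x - F x) <= e) ->
  nrm ('D_v S a - 'D_v F a) <= e / d * nrm v.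
Proof.
move=> ar N1 SP SF; have [L LP] := hol_derive_lim v FH d0 ar.
rewrite (hol_quadratic_derive ar (hol_quadratic_lim FH d0 ar LP)).
exact: LP N1 SP SF.
Qed.

Lemma hol_quadratic a v r z : nrm a < rho - d -> 0 < r -> r * nrm v <= d ->
  nrm z <= r / 2 ->
  nrm (F (a + z *: v) - F a - z *: 'D_v F a) <= 2 * M * (nrm z / r) ^+ 2.
Proof.
move=> ar; have [L LP] := hol_derive_lim v FH d0 ar.
have Q := hol_quadratic_lim FH d0 ar LP.
by rewrite (hol_quadratic_derive ar Q); exact: Q.
Qed.

(** The derivatives of the approximants serve as approximants, so the class can be differentiated
    repeatedly. *)
Lemma hol_derive v : hol (rho - d) (M / d * nrm v) (fun x => 'D_v F x).
Proof.
split=> [a ar|e e0].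
  apply: (@le_of_eps _ _ (2 * (nrm v / d))) => e e0.
  have [N [S [N1 SP SF SM]]] := hol_approx 1 FH e0.
  rewrite -(subKr ('D_v S a) ('D_v F a)).
  have := hol_derive_approx v ar N1 SP SF.
  have := line_poly_cauchy v N1 SP SM d0 ar.
  have := nrmB ('D_v S a) ('D_v S a - 'D_v F a).
  have -> : (M + e) / d * nrm v = M / d * nrm v + e * (nrm v / d) by ring.
  have -> : e / d * nrm v = e * (nrm v / d) by ring.
  by move: (nrm v / d) (M / d * nrm v) (nrm _) (nrm _) (nrm _) => *; lra.
have v1 : 0 < nrm v + 1 by rewrite ltr_wpDl ?nrm_ge0.
have e'0 : 0 < e * d / (nrm v + 1) by rewrite divr_gt0 ?mulr_gt0.
have [N [S [N1 SP SF SM]]] := hol_approx 1 FH e'0.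
exists N, (fun x => 'D_v S x); split; first exact: line_poly_derive.
move=> x xr; rewrite (le_trans (hol_derive_approx v xr N1 SP SF))//.
have -> : e * d / (nrm v + 1) / d * nrm v = e * nrm v / (nrm v + 1).
  by field; rewrite !gt_eqF.
by rewrite ler_pdivrMr// ler_wpM2l ?(ltW e0)// lerDl.
Qed.

(** [hol_quadratic] at [z = 1] and [r = d / nrm h]. The bound sees [h] only through its norm: this
    uniformity turns directional derivatives into Frechet derivatives. *)
Lemma hol_increment a h : nrm a < rho - d -> nrm h <= d / 2 ->
  nrm (F (a + h) - F a - 'D_h F a) <= 2 * M * (nrm h / d) ^+ 2.
Proof.
move=> ar hd; have [->|h0] := eqVneq h 0.
  by rewrite derive_dir0 addr0 !subrr nrm0 mul0r expr0n mulr0.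
have nh : 0 < nrm h.
  by rewrite lt_neqAle nrm_ge0 andbT eq_sym; apply: contra_neq h0; exact: nrm0_eq0.
have := @hol_quadratic a h (d / nrm h) 1 ar.
rewrite !scale1r nrm1 invf_div mul1r; apply.
- by rewrite divr_gt0.
- by rewrite divfK// gt_eqF.
- by rewrite mulrAC ler_pdivlMr// mul1r.
Qed.

Lemma hol_lipschitz a h : nrm a < rho - d -> nrm h <= d / 2 ->
  nrm (F (a + h) - F a) <= 2 * M / d * nrm h.
Proof.
move=> ar hd; have HI := hol_increment ar hd.
rewrite -(subrK ('D_h F a) (F (a + h) - F a)); move: HI.
have [DM _] := hol_derive h; have := DM a ar.
have := nrmD (F (a + h) - F a - 'D_h F a) ('D_h F a).
have M0 : 0 <= M.
  by apply: le_trans (nrm_ge0 _) (FH.1 a _); rewrite (lt_le_trans ar)// gerBl ltW.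
have q0 : 0 <= nrm h / d by rewrite divr_ge0 ?nrm_ge0 ?ltW.
have q1 : nrm h / d <= 2^-1 by rewrite ler_pdivrMr// mulrC.
have : 2 * M * (nrm h / d) ^+ 2 <= M * (nrm h / d).
  have q2 : 0 <= 1 - 2 * (nrm h / d) by lra.
  by have := mulr_ge0 (mulr_ge0 M0 q0) q2; move: (nrm h / d) => q; lra.
have -> : 2 * M / d * nrm h = 2 * (M * (nrm h / d)) by ring.
have -> : M / d * nrm h = M * (nrm h / d) by ring.
by move: (M * (nrm h / d)) (nrm _) (nrm _) (nrm _) => *; lra.
Qed.

End Derivative.

End UniformLimits.

(** * Linearity and symmetry of derivatives, Taylor expansion and composition in the class [hol] *)

Section Holomorphic.
Context {R : realType} {X : completeNormedModType R[i]}.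
Local Notation C := R[i].
Implicit Types (F G S T : X -> X) (a h v w x y : X) (rho M d e r : R).

Lemma nrm_dist_approx x y p (b : R) :
  nrm (p - x) <= b -> nrm (p - y) <= b -> nrm (x - y) <= 2 * b.
Proof.
move=> H1 H2; rewrite -(subrKA p) (le_trans (nrmD _ _))//.
by rewrite nrm_distC mulr_natl mulr2n lerD.
Qed.

Lemma hol_le rho rho' M F : rho' <= rho -> hol rho M F -> hol rho' M F.
Proof.
move=> le [FM FS]; split=> [x xr|e e0]; first by apply: FM; exact: lt_le_trans le.
have [N [S [SP SF]]] := FS e e0; exists N, S; split=> // x xr.
by apply: SF; exact: lt_le_trans le.
Qed.

Lemma hol_quadratic_near rho M F a v : hol rho M F -> nrm a < rho ->
  exists2 e, 0 < e & exists K, forall z : C, nrm z <= e ->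
    nrm (a + z *: v) < rho /\
    nrm (F (a + z *: v) - F a - z *: 'D_v F a) <= K * nrm z ^+ 2.
Proof.
move=> FH ar; pose d := (rho - nrm a) / 2.
have d0 : 0 < d by rewrite divr_gt0// subr_gt0.
have ad : nrm a < rho - d by rewrite /d; lra.
have v1 : 0 < nrm v + 1 by rewrite ltr_wpDl ?nrm_ge0.
pose r := d / (nrm v + 1); have r0 : 0 < r by rewrite divr_gt0.
have rv : r * nrm v <= d.
  by rewrite /r mulrAC ler_pdivrMr// ler_wpM2l ?(ltW d0)// lerDl.
exists (r / 2); first by rewrite divr_gt0.
exists (2 * M / r ^+ 2) => z zr; split.
  apply: ball_shift ad _; rewrite nrmZ (le_trans _ rv)// ler_wpM2r ?nrm_ge0//.
  by rewrite (le_trans zr)//; lra.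
by rewrite mulrAC -mulrA -expr_div_n; exact: (hol_quadratic FH d0 ad r0 rv zr).
Qed.

Lemma hol_derive_comb rho M M1 M2 F G1 G2 k a h :
  hol rho M F -> hol rho M1 G1 -> hol rho M2 G2 ->
  (forall x, nrm x < rho -> F x = k *: G1 x + G2 x) -> nrm a < rho ->
  'D_h F a = k *: 'D_h G1 a + 'D_h G2 a.
Proof.
move=> FH G1H G2H FE ar.
have [e1 e10 [K1 H1]] := hol_quadratic_near h G1H ar.
have [e2 e20 [K2 H2]] := hol_quadratic_near h G2H ar.
apply: (@derive_quadratic _ _ _ _ _ _ (Num.min e1 e2) (nrm k * K1 + K2)).
  by rewrite lt_min e10.
move=> z; rewrite le_min => /andP[z1 z2].
have [ar' {}H1] := H1 z z1; have [_ {}H2] := H2 z z2.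
rewrite !FE// (_ : _ - _ = k *: (G1 (a + z *: h) - G1 a - z *: 'D_h G1 a)
   + (G2 (a + z *: h) - G2 a - z *: 'D_h G2 a)); last first.
  rewrite !scalerBr !scalerDr !opprD !scalerA (mulrC k) !addrA.
  by rewrite [LHS](ACl (1*3*5*2*4*6))%AC.
rewrite mulrDl (le_trans (nrmD _ _))// lerD// nrmZ -mulrA.
by rewrite ler_wpM2l ?nrm_ge0.
Qed.

Lemma hol_deriveZ rho M F k a v : hol rho M F -> nrm a < rho ->
  'D_(k *: v) F a = k *: 'D_v F a.
Proof.
move=> FH ar; have [e e0 [K H]] := hol_quadratic_near v FH ar.
have k1 : 0 < nrm k + 1 by rewrite ltr_wpDl ?nrm_ge0.
apply: (@derive_quadratic _ _ _ _ _ _ (e / (nrm k + 1)) (K * nrm k ^+ 2)).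
  by rewrite divr_gt0.
move=> z ze; rewrite !scalerA.
have [|_] := H (z * k); last by rewrite -mulrA -exprMn (mulrC (nrm k)) -nrmM.
rewrite nrmM; apply: le_trans (_ : e / (nrm k + 1) * nrm k <= _).
  by rewrite ler_wpM2r ?nrm_ge0.
by rewrite mulrAC ler_pdivrMr// ler_wpM2l ?(ltW e0)// lerDl.
Qed.

(** Move first along [z *: v], then along [z *: w]. The second move involves ['D_w F] at the shifted
    point; ['D_w F] is in the class, hence Lipschitz, so shifting back costs [O(z^2)]. *)
Lemma hol_deriveD rho M F a v w : hol rho M F -> nrm a < rho ->
  'D_(v + w) F a = 'D_v F a + 'D_w F a.
Proof.
(* One [d] is spent on passing to ['D_w F], one on its Lipschitz estimate; the third keeps the
   inequality strict. *)
move=> FH ar; pose d := (rho - nrm a) / 3.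
have d0 : 0 < d by rewrite divr_gt0// subr_gt0.
have ad : nrm a < rho - d - d by rewrite /d; lra.
have GH := hol_derive FH d0 w.
pose m := nrm v + nrm w + 1.
have m0 : 0 < m by rewrite /m ltr_wpDl// addr_ge0 ?nrm_ge0.
pose r := d / m; have r0 : 0 < r by rewrite divr_gt0.
have rw : r * nrm w <= d.
  rewrite /r mulrAC ler_pdivrMr// ler_wpM2l ?(ltW d0)// /m.
  by have := nrm_ge0 v; lra.
have rv : r * nrm v <= d.
  rewrite /r mulrAC ler_pdivrMr// ler_wpM2l ?(ltW d0)// /m.
  by have := nrm_ge0 w; lra.
apply: (@derive_quadratic _ _ _ _ _ _ (r / 2)
  (2 * M / r ^+ 2 + (2 * (M / d * nrm w) / d * nrm v + 2 * M / r ^+ 2))).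
  by rewrite divr_gt0.
move=> z zr.
have zv : nrm (z *: v) <= d / 2.
  rewrite nrmZ (le_trans (ler_wpM2r (nrm_ge0 _) zr))//.
  by rewrite mulrAC ler_wpM2r// invr_ge0.
have H1 : nrm (F (a + z *: v + z *: w) - F (a + z *: v) - z *: 'D_w F (a + z *: v))
    <= 2 * M / r ^+ 2 * nrm z ^+ 2.
  rewrite mulrAC -mulrA -expr_div_n; apply: (hol_quadratic FH d0) => //.
  by apply: ball_shift ad _; lra.
have H2 : nrm (z *: ('D_w F (a + z *: v) - 'D_w F a))
    <= 2 * (M / d * nrm w) / d * nrm v * nrm z ^+ 2.
  have := hol_lipschitz GH d0 ad zv; rewrite !nrmZ => H.
  rewrite expr2 (mulrC (nrm z)) [leRHS]mulrA ler_wpM2r ?nrm_ge0//.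
  by rewrite (le_trans H)// mulrCA mulrC.
have H3 : nrm (F (a + z *: v) - F a - z *: 'D_v F a) <= 2 * M / r ^+ 2 * nrm z ^+ 2.
  by rewrite mulrAC -mulrA -expr_div_n; apply: (hol_quadratic FH d0) => //; lra.
have := lerD H1 (lerD H2 H3); rewrite -!mulrDl; apply: le_trans.
apply: le_trans (lerD (lexx _) (nrmD _ _)); apply: le_trans (nrmD _ _).
rewrite le_eqVlt; apply/orP; left; apply/eqP; congr nrm.
rewrite !scalerBr !scalerDr !opprD !addrA.
rewrite [RHS](ACl (1*7*8*5*(3*4)*(2*6)))%AC/=.
by rewrite !addNr !addr0.
Qed.

(** Both mixed derivatives of [F] lie within a multiple of [e] of the common mixed derivative of an
    approximant. *)
Lemma hol_deriveC rho M F a h v : hol rho M F -> nrm a < rho ->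
  'D_v (fun x => 'D_h F x) a = 'D_h (fun x => 'D_v F x) a.
Proof.
move=> FH ar; pose d := (rho - nrm a) / 3.
have d0 : 0 < d by rewrite divr_gt0// subr_gt0.
have ad : nrm a < rho - d - d by rewrite /d; lra.
apply/eqP; rewrite -subr_eq0; apply/eqP; apply: nrm0_eq0; apply/eqP.
rewrite eq_le nrm_ge0 andbT.
apply: (@le_of_eps _ _ _ (2 * (nrm h / d * (nrm v / d)))) => e e0; rewrite add0r.
have [N [S [N1 SP SF _]]] := hol_approx 1 FH e0.
have close u w : nrm ('D_w (fun x => 'D_u S x) a - 'D_w (fun x => 'D_u F x) a)
    <= e * (nrm u / d * (nrm w / d)).
  have uS := line_poly_derive u N1 SP.
  rewrite (_ : e * _ = e / d * nrm u / d * nrm w); last by ring.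
  apply: (hol_derive_approx (hol_derive FH d0 u) d0 _ ad N1 uS) => x xr.
  exact: (hol_derive_approx FH d0 _ xr N1 SP SF).
have H1 := close h v; have H2 := close v h.
rewrite (mulrC (nrm v / d)) -(derive_line_polyC _ _ _ N1 SP) in H2.
by rewrite mulrCA; exact: nrm_dist_approx H2.
Qed.

Definition iter_derive x k F := iter k (fun G y => 'D_x G y) F.

Lemma hol_iter_derive rho M F d x k : hol rho M F -> 0 < d ->
  hol (rho - k%:R * d) (M * (nrm x / d) ^+ k) (iter_derive x k F).
Proof.
move=> FH d0; elim: k => [|k IH]; first by rewrite mul0r subr0 mulr1.
rewrite (_ : rho - k.+1%:R * d = rho - k%:R * d - d); last by rewrite -natr1; ring.
rewrite exprSr mulrA (_ : _ * (nrm x / d) = M * (nrm x / d) ^+ k / d * nrm x).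
  exact: hol_derive IH d0 x.
by ring.
Qed.

Lemma line_poly_iter_derive N S x k : (1 < N)%N -> line_poly N S ->
  line_poly N (iter_derive x k S).
Proof. by move=> N1 SP; elim: k => // k IH; exact: line_poly_derive. Qed.

Lemma iter_derive_approx rho M F d x k e N S : hol rho M F -> 0 < d ->
  (1 < N)%N -> line_poly N S ->
  (forall y, nrm y < rho -> nrm (S y - F y) <= e) ->
  forall y, nrm y < rho - k%:R * d ->
  nrm (iter_derive x k S y - iter_derive x k F y) <= e * (nrm x / d) ^+ k.
Proof.
move=> FH d0 N1 SP SF; elim: k => [|k IH] y.
  by rewrite mul0r subr0 mulr1; exact: SF.
rewrite (_ : rho - k.+1%:R * d = rho - k%:R * d - d); last by rewrite -natr1; ring.
move=> yr; rewrite exprSr (_ : _ * _ = e * (nrm x / d) ^+ k / d * nrm x); last by ring.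
exact: (hol_derive_approx (hol_iter_derive x k FH d0) d0 x yr N1
  (line_poly_iter_derive x k N1 SP) IH).
Qed.

(** Expand [S ((z + t) *: x)] by the binomial theorem and read off the coefficient of [t]; the top
    index has no successor below [N], hence the [if]. *)
Lemma derive_along N S x (b : nat -> X) z : (1 < N)%N ->
  (forall z : C, S (z *: x) = \sum_(j < N) z ^+ j *: b j) ->
  'D_x S (z *: x) = \sum_(j < N) z ^+ j *:
    (if (j.+1 < N)%N then j.+1%:R *: b j.+1 else 0).
Proof.
move=> N1 SE.
rewrite (@derive_vpoly _ _ N _ _ _
  (fun i => \sum_(j < N) 'C(j, i)%:R *: (z ^+ (j - i) *: b j)))//; last first.
  move=> t; rewrite -scalerDl SE.
  under [RHS]eq_bigr do rewrite scaler_sumr.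
  rewrite exchange_big/=; apply: eq_bigr => j _.
  rewrite exprDn scaler_suml (big_ord_widen N (fun i =>
    ((z ^+ (j - i) * t ^+ i) *+ 'C(j, i)) *: b j))// big_mkcond.
  apply: eq_bigr => i _; rewrite ltnS; case: leqP => ij.
    rewrite !scalerA -mulr_natl; congr (_ *: _).
    by move: (z ^+ _) (t ^+ _) => p q; ring.
  by rewrite bin_small// !(scale0r, scaler0).
case: N N1 {SE} => // N _; rewrite big_ord_recl big_ord_recr/= ltnn scaler0 addr0.
rewrite bin0n scale0r add0r; apply: eq_bigr => j _.
by rewrite ltnS ltn_ord /bump/= bin1 subn1 !scalerA mulrC.
Qed.

Lemma iter_derive_along N S x (c : nat -> X) k z : (1 < N)%N ->
  line_poly N S -> (forall z : C, S (z *: x) = \sum_(j < N) z ^+ j *: c j) ->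
  iter_derive x k S (z *: x) = \sum_(j < N) z ^+ j *:
    (if (j + k < N)%N then ((j + k) ^_ k)%:R *: c (j + k)%N else 0).
Proof.
move=> N1 SP SE; elim: k z => [|k IH] z.
  by rewrite [LHS]SE; apply: eq_bigr => j _; rewrite addn0 ltn_ord ffactn0 scale1r.
pose b j := if (j + k < N)%N then ((j + k) ^_ k)%:R *: c (j + k)%N else 0.
rewrite [LHS](@derive_along N _ x b z N1 IH) /b; apply: eq_bigr => j _; congr (_ *: _).
rewrite addSnnS; case: ifPn => [_|]; last first.
  by rewrite -leqNgt => jN; rewrite ifN// -leqNgt; lia.
case: ifP => _; last by rewrite scaler0.
rewrite scalerA -natrM ffactnSr mulnC; congr ((_ * _)%:R *: _).
by rewrite addnS -addSn addnK.
Qed.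

(** For an approximant the coefficients along [x] are its iterated derivatives over factorials, and
    [coef_tail] bounds the rest. All constants are independent of the degree, so [e] may tend to
    0. *)
Lemma hol_taylor rho M F x n : hol rho M F -> 0 < rho ->
  exists2 r, 0 < r & exists K, forall z : C, nrm z <= r ->
    nrm (F (z *: x) - \sum_(k < n) z ^+ k *: ((k`!%:R)^-1 *: iter_derive x k F 0))
      <= K * nrm z ^+ n.
Proof.
move=> FH rho0; have x1 : 0 < nrm x + 1 by rewrite ltr_wpDl ?nrm_ge0.
(* Each derivative costs [d] of the radius, and [n * d < rho] keeps 0 inside the ball. *)
pose d := rho / n.+1%:R; have d0 : 0 < d by rewrite divr_gt0.
pose r := rho / (2 * (nrm x + 1)); have r0 : 0 < r by rewrite divr_gt0// mulr_gt0.
have rx : r * nrm x < rho.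
  rewrite /r mulrAC ltr_pdivrMr ?mulr_gt0// ltr_pM2l//.
  by have := nrm_ge0 x; lra.
exists (r / 2); first by rewrite divr_gt0.
exists (2 * M / r ^+ n) => z zr.
rewrite mulrAC -mulrA -expr_div_n.
apply: (@le_of_eps _ _ _ (2 * (nrm z / r) ^+ n + 1 +
  \sum_(k < n) nrm z ^+ k * ((k`!%:R)^-1 * (nrm x / d) ^+ k))) => e e0.
have [N [S [N1 SP SF SM]]] := hol_approx n.+1 FH e0.
have Nn := ltnW N1; have {}N1 : (1 < N)%N by apply: leq_ltn_trans N1.
have [c cE] := SP 0 x.
have {}cE z' : S (z' *: x) = \sum_(j < N) z' ^+ j *: c j by rewrite -cE add0r.
have cD k : (k < n)%N -> c k = (k`!%:R)^-1 *: iter_derive x k S 0.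
  move=> kn; rewrite -(scale0r x) (iter_derive_along _ _ N1 SP cE).
  case: N {SP SF SM} N1 Nn cE => // N N1 Nn cE.
  rewrite big_ord_recl/= expr0 scale1r add0n big1 ?addr0 => [|j _]; last first.
    by rewrite exprS mul0r scale0r.
  rewrite (ltn_trans kn Nn) ffactnn scalerA mulVf ?scale1r//.
have zx t : nrm t <= r -> nrm (t *: x) < rho.
  by move=> tr; rewrite nrmZ (le_lt_trans _ rx)// ler_wpM2r ?nrm_ge0.
have SrM t : nrm t = r -> nrm (S (t *: x)) <= M + e.
  by move=> tE; apply: SM; apply: zx; rewrite tE.
have H1 := coef_tail Nn r0 cE SrM zr.
have zr' : nrm z <= r by apply: le_trans zr _; lra.
have H2 := SF _ (zx _ zr').
set A := \sum_(k < n) _ *: (_ *: _).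
set B := \sum_(j < n) _ *: c j in H1.
set K := \sum_(k < n) _.
have H3 : nrm (B - A) <= e * K.
  rewrite /A /B /K -sumrB mulr_sumr (le_trans (nrm_sum _ _ _))//.
  apply: ler_sum => k _; rewrite -scalerBr nrmZ nrmX mulrCA.
  rewrite ler_wpM2l ?exprn_ge0 ?nrm_ge0// cD// -scalerBr nrmZ nrmV nrm_nat mulrCA.
  rewrite ler_wpM2l ?invr_ge0 ?ler0n//.
  apply: (iter_derive_approx x FH d0 N1 SP SF); rewrite nrm0 subr_gt0.
  rewrite /d mulrCA -ltr_pdivlMl// mulVf ?gt_eqF// ltr_pdivrMr// mul1r.
  by rewrite ltr_nat ltnS ltnW.
have -> : F (z *: x) - A = (S (z *: x) - B) - (S (z *: x) - F (z *: x)) + (B - A).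
  by rewrite opprB !addrA [RHS](ACl (3*6*(1*4)*(2*5)))%AC/= subrr addNr !addr0.
apply: le_trans (nrmD _ _) _.
have := nrmB (S (z *: x) - B) (S (z *: x) - F (z *: x)).
move: H1 H2 H3; move: ((nrm z / r) ^+ n) K (nrm _) (nrm _) (nrm _) (nrm _) => *; lra.
Qed.

(** Composites of approximants are approximants; the Lipschitz bound of [f] carries the inner error
    outwards, and [g 0 = 0] with the Lipschitz bound of [g] keeps the inner values small. *)
Lemma hol_comp rf rg Mf Mg f g : hol rf Mf f -> hol rg Mg g -> 0 < rf ->
  0 < rg -> g 0 = 0 -> exists2 rho, 0 < rho &
    hol rho Mf (f \o g) /\ forall x, nrm x < rho -> nrm (g x) < rf.
Proof.
move=> fH gH rf0 rg0 g0.
have gd0 : 0 < rg / 2 by rewrite divr_gt0.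
pose L := `|2 * Mg / (rg / 2)| + 1; have L0 : 0 < L by rewrite ltr_wpDl.
pose df := rf / 4; have df0 : 0 < df by rewrite divr_gt0.
pose rho := Num.min (rg / 4) (df / L).
have rho0 : 0 < rho by rewrite lt_min !divr_gt0.
have gr x : nrm x < rho -> nrm (g x) < df.
  rewrite lt_min => /andP[x1 x2].
  have := @hol_lipschitz _ _ _ _ _ _ gH gd0 0 x; rewrite nrm0 add0r g0 subr0 => H.
  apply: le_lt_trans (H _ _) _; [by lra|by lra|].
  rewrite ltr_pdivlMr// mulrC in x2; apply: le_lt_trans x2.
  rewrite ler_wpM2r ?nrm_ge0// /L (le_trans (ler_norm _))//.
  by rewrite lerDl.
exists rho => //; split; last first.
  by move=> x xr; rewrite (lt_le_trans (gr x xr))// /df; lra.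
split=> [x xr|e e0] /=.
  by apply: fH.1; rewrite (lt_le_trans (gr x xr))// /df; lra.
pose L' := `|2 * Mf / df| + 1; have L'0 : 0 < L' by rewrite ltr_wpDl.
(* The first entry keeps [T x] in the range of the Lipschitz estimate of [f]; the second makes the
   transported error at most [e / 2]. *)
pose e' := Num.min (df / 2) (e / 2 / L').
have e'0 : 0 < e' by rewrite lt_min !divr_gt0.
have e20 : 0 < e / 2 by rewrite divr_gt0.
have [N [S [SP SF]]] := fH.2 _ e20.
have [N' [T [TP TG]]] := gH.2 _ e'0.
have [K STP] := line_poly_comp SP TP.
exists K, (S \o T); split=> // x xr /=.
have gx := gr x xr.
have Tx : nrm (T x - g x) <= e'.
  by apply: TG; move: xr; rewrite lt_min => /andP[x1 _]; lra.
have [Tx1 Tx2] : nrm (T x - g x) <= df / 2 /\ nrm (T x - g x) <= e / 2 / L'.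
  by apply/andP; rewrite -le_min.
have Tr : nrm (T x) < rf.
  by have := nrmD (T x - g x) (g x); rewrite subrK /df in gx Tx1 *; lra.
have gx' : nrm (g x) < rf - df by rewrite /df in gx *; lra.
have := hol_lipschitz fH df0 gx' Tx1; rewrite addrCA subrr addr0 => H.
have {}H : nrm (f (T x) - f (g x)) <= e / 2.
  apply: le_trans H _; rewrite ler_pdivlMr// mulrC in Tx2; apply: le_trans Tx2.
  by rewrite ler_wpM2r ?nrm_ge0// /L' (le_trans (ler_norm _))// lerDl.
rewrite -(subrKA (f (T x))) (le_trans (nrmD _ _))// [leRHS]splitr.
by rewrite lerD// SF.
Qed.

End Holomorphic.

(** * Frechet derivatives *)

Section FrechetDerivatives.
Context {R : realType} {X : completeNormedModType R[i]}.
Local Notation C := R[i].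
Implicit Types (F G : X -> X) (a h x y : X) (rho M d : R).

Lemma linear_scale (f : X -> X) k x : linear f -> f (k *: x) = k *: f x.
Proof.
move=> fl; have f0 : f 0 = 0.
  by apply: (addrI (f 0)); have := fl 1 0 0; rewrite !scale1r !addr0.
by have := fl k x 0; rewrite addr0 f0 addr0.
Qed.

Lemma near0_nrmP (P : X -> Prop) : (\forall y \near (0 : X), P y) <->
  exists2 r : R, 0 < r & forall y, nrm y < r -> P y.
Proof.
split=> [/nbhs_ballP[r r0 rP]|[r r0 rP]].
  have rE : r = (complex.Re r)%:C by rewrite RRe_real// gtr0_real.
  exists (complex.Re r); first by rewrite -ltcR -rE.
  move=> y yr; apply: rP; rewrite -ball_normE /ball_/= sub0r normrN.
  by rewrite rE nrm_lt.
apply/nbhs_ballP; exists r%:C; first by rewrite /= ltcR.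
by move=> y; rewrite -ball_normE /ball_/= sub0r normrN nrm_lt; exact: rP.
Qed.

Lemma prod_nrm n (v : n.-tuple X) :
  \prod_(i < n) `|tnth v i| = (\prod_(i < n) nrm (tnth v i))%:C.
Proof. by rewrite rmorph_prod; apply: eq_bigr => i _; rewrite nrmE. Qed.

Lemma is_frechet_derivativeP n (F : X -> n.-tuple X -> X) a L :
  is_frechet_derivative F a L <-> bounded_multilinear L /\
  forall e : R, 0 < e -> exists2 r : R, 0 < r &
    forall h, nrm h < r -> forall v : n.-tuple X,
      nrm (F (a + h) v - F a v - L [tuple of h :: v])
      <= e * nrm h * \prod_(i < n) nrm (tnth v i).
Proof.
have E (e : R) h (v : n.-tuple X) : (`|F (a + h) v - F a v - L [tuple of h :: v]|
        <= e%:C * `|h| * \prod_(i < n) `|tnth v i|) =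
    (nrm (F (a + h) v - F a v - L [tuple of h :: v])
      <= e * nrm h * \prod_(i < n) nrm (tnth v i)).
  by rewrite prod_nrm (nrmE h) -nrm_le !rmorphM.
split=> -[Lm LF]; split=> // e e0.
  have [|r r0 rP] := (near0_nrmP _).1 (LF e%:C _); first by rewrite ltcR.
  by exists r => // h hr v; rewrite -E; exact: rP.
have eE : e = (complex.Re e)%:C by rewrite RRe_real// gtr0_real.
have [|r r0 rP] := LF (complex.Re e); first by rewrite -ltcR -eE.
by apply/near0_nrmP; exists r => // h hr v; rewrite eE E; exact: rP.
Qed.

Lemma multilinear_cons_scale n (L : n.+1.-tuple X -> X) k h (v : n.-tuple X) :
  multilinear L -> L [tuple of k *: h :: v] = k *: L [tuple of h :: v].
Proof.
move=> Lm; have E y : L [tuple of y :: v] =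
    L [tuple if j == ord0 then y else tnth [tuple of h :: v] j | j < n.+1].
  congr L; apply: eq_from_tnth => j; rewrite tnth_mktuple.
  by case: (unliftP ord0 j) => [i ->|->]; rewrite ?tnthS ?tnth0.
by rewrite !E; exact: linear_scale (Lm ord0 _).
Qed.

(** Shrinking [h] by [s] brings it where both estimates hold; homogeneity in the first slot then
    cancels [s]. This pins down the value selected by [xget]. *)
Lemma is_frechet_derivative_unique n (F : X -> n.-tuple X -> X) a L L' :
  is_frechet_derivative F a L -> is_frechet_derivative F a L' -> L = L'.
Proof.
move=> /is_frechet_derivativeP[[Lm _] LF] /is_frechet_derivativeP[[L'm _] L'F].
apply/funext => t; case/tupleP: t => h v.
apply/eqP; rewrite -subr_eq0; apply/eqP/nrm0_eq0/eqP; rewrite eq_le nrm_ge0 andbT.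
pose P : R := nrm h * \prod_(i < n) nrm (tnth v i).
apply: (@le_of_eps _ _ _ (2 * P)) => e e0; rewrite add0r mulrCA.
have [r r0 rP] := LF e e0; have [r' r'0 r'P] := L'F e e0.
have h1 : 0 < nrm h + 1 by rewrite ltr_wpDl ?nrm_ge0.
pose m := Num.min r r'; have m0 : 0 < m by rewrite lt_min r0.
pose s := m / (nrm h + 1); have s0 : 0 < s by rewrite divr_gt0.
have nsh : nrm (s%:C *: h) = s * nrm h by rewrite nrmZ nrmC ?ltW.
have : nrm (s%:C *: h) < m.
  by rewrite nsh mulrAC ltr_pdivrMr// ltr_pM2l// ltrDl.
rewrite lt_min => /andP[sr sr'].
have H1 := rP _ sr v; have H2 := r'P _ sr' v.
rewrite -(ler_pM2l s0) -{1}(nrmC (ltW s0)) -nrmZ scalerBr.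
rewrite -(multilinear_cons_scale _ _ _ Lm) -(multilinear_cons_scale _ _ _ L'm).
have := nrm_dist_approx H1 H2.
rewrite nsh => H; apply: le_trans H _; rewrite le_eqVlt /P.
by apply/orP; left; apply/eqP; ring.
Qed.

Lemma eq_is_frechet_derivative n (F G : X -> n.-tuple X -> X) a L (rho : R) :
  (forall x, nrm x < rho -> F x = G x) -> nrm a < rho ->
  is_frechet_derivative F a L -> is_frechet_derivative G a L.
Proof.
move=> FG ar /is_frechet_derivativeP[Lm LF]; apply/is_frechet_derivativeP.
split=> // e e0; have [r r0 rP] := LF e e0.
exists (Num.min r (rho - nrm a)) => [|h]; first by rewrite lt_min r0 subr_gt0.
rewrite lt_min => /andP[hr ha] v; rewrite -!FG//; first exact: rP.
by rewrite (le_lt_trans (nrmD _ _))//; lra.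
Qed.

(** The explicit candidate for [Dn]. The head of the tuple is the direction of the last
    differentiation, as in the currying of [is_frechet_derivative]. *)
Fixpoint iter_dir n F : X -> n.-tuple X -> X :=
  match n with
  | 0 => fun a _ => F a
  | k.+1 => fun a t => 'D_(thead t) (fun b => iter_dir F b (behead_tuple t)) a
  end.

Lemma behead_tuple_cons n h (v : n.-tuple X) :
  behead_tuple [tuple of h :: v] = v :> n.-tuple X.
Proof. exact: val_inj. Qed.

Lemma iter_dirS n F a h (v : n.-tuple X) :
  iter_dir F a [tuple of h :: v] = 'D_h (fun b => iter_dir F b v) a.
Proof.
rewrite /= theadE (_ : (fun b => _) = (iter_dir F)^~ v)//.
by apply/funext => b; rewrite behead_tuple_cons.
Qed.

Lemma iter_dir_nseq n F a x :
  iter_dir F a [tuple of nseq n x] = iter_derive x n F a.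
Proof.
elim: n a => [//|n IH] a.
rewrite (_ : [tuple of _] = [tuple of x :: nseq n x]); last exact: val_inj.
rewrite iter_dirS (_ : (fun b => _) = iter_derive x n F)//.
by apply/funext => b; rewrite IH.
Qed.

Lemma hol_iter_dir rho M F d n (t : n.-tuple X) : hol rho M F -> 0 < d ->
  hol (rho - n%:R * d) (M / d ^+ n * \prod_(i < n) nrm (tnth t i))
    (fun a => iter_dir F a t).
Proof.
move=> FH d0; elim: n t => [|n IH] t.
  by rewrite big_ord0 mul0r subr0 expr0 divr1 mulr1.
case/tupleP: t => h v.
rewrite (_ : (fun a => _) = (fun a => 'D_h (fun b => iter_dir F b v) a)); last first.
  by apply/funext => a; rewrite iter_dirS.
rewrite (_ : rho - _ = rho - n%:R * d - d); last by rewrite -natr1; ring.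
rewrite big_ord_recl tnth0.
under eq_bigr do rewrite tnthS.
rewrite (_ : M / d ^+ n.+1 * _ = M / d ^+ n * \prod_(i < n) nrm (tnth v i) / d * nrm h).
  exact: hol_derive (IH v) d0 h.
by rewrite exprS invfM; ring.
Qed.

Definition tuple_set n (i : 'I_n) (v : n.-tuple X) x : n.-tuple X :=
  [tuple if j == i then x else tnth v j | j < n].

Lemma tuple_set0 n (v : n.+1.-tuple X) x :
  tuple_set ord0 v x = [tuple of x :: behead_tuple v].
Proof.
case/tupleP: v => h v; apply: eq_from_tnth => j; rewrite tnth_mktuple.
case: (unliftP ord0 j) => [i ->|->]; rewrite ?tnthS ?tnth0//=.
by rewrite behead_tuple_cons.
Qed.

Lemma tuple_setS n (i : 'I_n) (v : n.+1.-tuple X) x :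
  tuple_set (lift ord0 i) v x =
  [tuple of thead v :: tuple_set i (behead_tuple v) x].
Proof.
case/tupleP: v => h v; apply: eq_from_tnth => j; rewrite tnth_mktuple.
case: (unliftP ord0 j) => [k ->|->]; rewrite ?tnthS ?tnth0//=.
by rewrite behead_tuple_cons tnth_mktuple (inj_eq (@lift_inj _ _)).
Qed.

(** Slots behind the head go by induction, the outer derivative being linear in the map; the head
    slot is linearity in the direction. *)
Lemma iter_dir_multilinear rho M F d n a : hol rho M F -> 0 < d ->
  nrm a < rho - n%:R * d -> multilinear (iter_dir (n := n) F a).
Proof.
move=> FH d0; elim: n a => [|n IH] a ar; first by case.
have an : nrm a < rho - n%:R * d by move: ar; rewrite -natr1; lra.
move=> i v k x y; rewrite -!/(tuple_set i v _).
case: (unliftP ord0 i) => [i' ->|->].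
  rewrite !tuple_setS !iter_dirS.
  apply: (hol_derive_comb _ (hol_iter_dir _ FH d0) (hol_iter_dir _ FH d0)
    (hol_iter_dir _ FH d0) _ an) => b bn.
  exact: (IH b bn i').
have vH := hol_iter_dir (behead_tuple v) FH d0.
by rewrite !tuple_set0 !iter_dirS (hol_deriveD _ _ vH an) (hol_deriveZ _ _ vH an).
Qed.

Lemma iter_dir_bounded_multilinear rho M F d n a : hol rho M F -> 0 < d ->
  nrm a < rho - n%:R * d -> bounded_multilinear (iter_dir (n := n) F a).
Proof.
move=> FH d0 ar; split; first exact: iter_dir_multilinear FH d0 ar.
exists (M / d ^+ n)%:C => v; rewrite prod_nrm -rmorphM nrm_le.
exact: (hol_iter_dir v FH d0).1.
Qed.

(** The bound in [hol_iter_dir] contains the product of the norms of the entries of [v], so the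
    remainder of [hol_increment] is uniform in [v], as the operator norm demands. *)
Lemma iter_dir_frechet rho M F d n a : hol rho M F -> 0 < d ->
  nrm a < rho - n.+1%:R * d ->
  is_frechet_derivative (iter_dir (n := n) F) a (iter_dir (n := n.+1) F a).
Proof.
move=> FH d0 ar; apply/is_frechet_derivativeP.
split=> [|e e0]; first exact: iter_dir_bounded_multilinear FH d0 ar.
pose K := 2 * (M / d ^+ n) / d ^+ 2.
have K1 : 0 < `|K| + 1 by rewrite ltr_wpDl.
exists (Num.min (d / 2) (e / (`|K| + 1))) => [|h].
  by rewrite lt_min !divr_gt0.
rewrite lt_min => /andP[hd he] v; rewrite iter_dirS.
have ar' : nrm a < rho - n%:R * d - d by move: ar; rewrite -natr1; lra.
have := hol_increment (hol_iter_dir v FH d0) d0 ar' (ltW hd).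
move=> /le_trans; apply.
set P := \prod_(i < n) _.
have P0 : 0 <= P by rewrite prodr_ge0// => i _; exact: nrm_ge0.
rewrite (_ : _ * _ ^+ 2 = K * nrm h * nrm h * P); last by rewrite /K expr_div_n; ring.
rewrite ler_wpM2r// ler_wpM2r ?nrm_ge0//.
rewrite ltr_pdivlMr// mulrC in he; apply: le_trans (ltW he).
by rewrite ler_wpM2r ?nrm_ge0// (le_trans (ler_norm _))// lerDl.
Qed.

(** By induction the two maps agree on a ball only, which suffices since Frechet derivatives are
    local. *)
Lemma Dn_iter_dir rho M F d n a : hol rho M F -> 0 < d ->
  nrm a < rho - n%:R * d -> Dn (k := n) F a = iter_dir F a.
Proof.
move=> FH d0; elim: n a => [//|n IH] a ar.
have ar' : nrm a < rho - n%:R * d by move: ar; rewrite -natr1; lra.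
have H : is_frechet_derivative (Dn (k := n) F) a (iter_dir (n := n.+1) F a).
  apply: eq_is_frechet_derivative ar' (iter_dir_frechet FH d0 ar) => x xr.
  by rewrite IH.
apply: (is_frechet_derivative_unique _ H).
exact: (@xgetPex _ (fun=> 0) [set L | is_frechet_derivative (Dn (k := n) F) a L]
  (ex_intro _ _ H)).
Qed.

(** The default operator 0 of [xget] is itself bounded and multilinear, so [taylor_poly] is
    homogeneous for an arbitrary map. *)
Lemma Dn_bounded_multilinear F a n : bounded_multilinear (Dn (k := n.+1) F a).
Proof.
rewrite /= /frechet_derivative; case: xgetP => [L _ []//|_].
split=> [i v k x y|]; first by rewrite scaler0 addr0.
by exists 0 => v; rewrite normr0 mul0r.
Qed.

Lemma Dn0_iter_dir rho M F n : hol rho M F -> 0 < rho ->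
  Dn (k := n) F 0 = iter_dir F 0.
Proof.
move=> FH rho0; apply: (Dn_iter_dir (d := rho / n.+1%:R) FH).
  by rewrite divr_gt0.
by rewrite nrm0 subr_gt0 mulrCA gtr_pMr// ltr_pdivrMr// mul1r ltr_nat.
Qed.

Lemma taylor_polyE rho M F n x : hol rho M F -> 0 < rho ->
  taylor_poly n F x = (n`!%:R)^-1 *: iter_derive x n F 0.
Proof.
move=> FH rho0.
by rewrite /taylor_poly (Dn0_iter_dir _ FH rho0) iter_dir_nseq.
Qed.

Lemma Dn2_sym rho M F u v : hol rho M F -> 0 < rho ->
  Dn (k := 2) F 0 [tuple u; v] = Dn (k := 2) F 0 [tuple v; u].
Proof.
move=> FH rho0; rewrite (Dn0_iter_dir _ FH rho0).
have E x y : iter_dir F 0 [tuple x; y] = 'D_x (fun b => 'D_y F b) 0 :> X.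
  rewrite (_ : [tuple x; y] = [tuple of x :: [tuple of y :: [tuple]]]);
    last exact: val_inj.
  by rewrite iter_dirS.
by rewrite !E; apply: (hol_deriveC _ _ FH); rewrite nrm0.
Qed.

End FrechetDerivatives.

(** * Normalized mappings *)

Section TaylorSeries.
Context {R : realType} {X : completeNormedModType R[i]}.
Local Notation C := R[i].
Implicit Types (f : X -> X) (a h x y : X).

(** Interpolates from [t] to [u] as [m] grows, so that multilinearity can be applied to one slot at
    a time. *)
Definition mixed_tuple n m (u t : n.-tuple X) : n.-tuple X :=
  [tuple if (i < m)%N then tnth u i else tnth t i | i < n].

Lemma mixed_tuple0 n (u t : n.-tuple X) : mixed_tuple 0 u t = t.
Proof. by apply: eq_from_tnth => i; rewrite tnth_mktuple. Qed.

Lemma mixed_tuple_full n (u t : n.-tuple X) : mixed_tuple n u t = u.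
Proof. by apply: eq_from_tnth => i; rewrite tnth_mktuple ltn_ord. Qed.

Lemma mixed_tupleS n m (mn : (m < n)%N) (u t : n.-tuple X) :
  mixed_tuple m.+1 u t =
  tuple_set (Ordinal mn) (mixed_tuple m u t) (tnth u (Ordinal mn)).
Proof.
apply: eq_from_tnth => i; rewrite !tnth_mktuple ltnS leq_eqVlt -val_eqE /=.
case: eqP => //= im; congr (tnth u _); exact: val_inj.
Qed.

Lemma tuple_set_mixed n m (mn : (m < n)%N) (u t : n.-tuple X) x :
  tuple_set (Ordinal mn) (mixed_tuple m u t) x =
  mixed_tuple m u (tuple_set (Ordinal mn) t x).
Proof.
apply: eq_from_tnth => i; rewrite !tnth_mktuple -val_eqE /=.
by case: eqP => [->|//]; rewrite ltnn.
Qed.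

Lemma multilinear_setD n (A : n.-tuple X -> X) i v k x y : multilinear A ->
  A (tuple_set i v (x + k *: y)) = A (tuple_set i v x) + k *: A (tuple_set i v y).
Proof. by move=> Am; rewrite addrC [RHS]addrC; exact: (Am i v k y x). Qed.

Lemma multilinear_vpoly n (A : n.-tuple X -> X) m (u w t : n.-tuple X) :
  multilinear A -> (m <= n)%N -> vpoly m.+1
    (fun z => A (mixed_tuple m [tuple tnth u i + z *: tnth w i | i < n] t)).
Proof.
move=> Am; elim: m t => [|m IH] t mn.
  by exists (fun=> A t) => z; rewrite mixed_tuple0 big_ord1 expr0 scale1r.
have [c cE] := vpolyD
  (vpoly_widen (leqnSn _)
    (IH (tuple_set (Ordinal mn) t (tnth u (Ordinal mn))) (ltnW mn)))
  (vpolyM 1%N (IH (tuple_set (Ordinal mn) t (tnth w (Ordinal mn))) (ltnW mn))).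
exists c => z; rewrite -cE mixed_tupleS tnth_mktuple.
by rewrite -!tuple_set_mixed; exact: multilinear_setD.
Qed.

Lemma multilinear_homog n (A : n.-tuple X -> X) m (u : n.-tuple X) (z : C) :
  multilinear A -> (m <= n)%N ->
  A (mixed_tuple m [tuple z *: tnth u i | i < n] u) = z ^+ m *: A u.
Proof.
move=> Am; elim: m => [|m IH] mn; first by rewrite mixed_tuple0 scale1r.
rewrite mixed_tupleS tnth_mktuple (linear_scale z _ (Am (Ordinal mn) _)).
rewrite exprS -scalerA -IH 1?ltnW//; congr (_ *: A _).
apply: eq_from_tnth => i; rewrite !tnth_mktuple -val_eqE /=.
by case: eqP => // im; rewrite im ltnn; congr (tnth u _); apply: val_inj.
Qed.

Lemma taylor_poly_homog f n (z : C) x :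
  taylor_poly n.+1 f (z *: x) = z ^+ n.+1 *: taylor_poly n.+1 f x.
Proof.
have [Am _] := Dn_bounded_multilinear f 0 n.
rewrite /taylor_poly !scalerA mulrC -scalerA; congr (_ *: _).
rewrite -(multilinear_homog _ z Am (leqnn _)); congr (Dn _ _ _).
by apply: eq_from_tnth => i; rewrite mixed_tuple_full tnth_mktuple !tnth_nseq.
Qed.

Lemma taylor_poly_line_poly f n : line_poly n.+2 (taylor_poly n.+1 f).
Proof.
move=> a h; apply: vpolyZ; have [Am _] := Dn_bounded_multilinear f 0 n.
have [c cE] := multilinear_vpoly [tuple of nseq n.+1 a] [tuple of nseq n.+1 h]
  [tuple of nseq n.+1 a] Am (leqnn _).
exists c => z; rewrite -cE; congr (Dn _ _ _).
by apply: eq_from_tnth => i; rewrite mixed_tuple_full tnth_mktuple !tnth_nseq.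
Qed.

Definition taylor_sum f n x := x + \sum_(2 <= k < n) taylor_poly k f x.

Lemma taylor_sumS f n x : (1 < n)%N ->
  taylor_sum f n.+1 x = taylor_sum f n x + taylor_poly n f x.
Proof. by move=> n1; rewrite /taylor_sum big_nat_recr// addrA. Qed.

(** The bound [n.+2] instead of [n] makes room for the linear term when [n < 2]. *)
Lemma taylor_sum_line_poly f n : line_poly n.+2 (taylor_sum f n).
Proof.
elim: n => [|n IH] a h.
  exists (fun j => if j is 0 then a else h) => z.
  rewrite /taylor_sum big_geq// addr0 big_ord_recl big_ord1 /=.
  by rewrite expr0 scale1r expr1.
have [n1|n1] := leqP n 1.
  have E : taylor_sum f n.+1 = taylor_sum f n.
    by apply/funext => x; rewrite /taylor_sum !big_geq// ltnW.
  by rewrite E; exact: vpoly_widen (IH a h).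
have [|c cE] := vpolyD (vpoly_widen (leqnSn n.+2) (IH a h))
  (_ : vpoly n.+3 (fun z => taylor_poly n f (a + z *: h))).
  case: n n1 {IH} => // n _.
  by apply: vpoly_widen (taylor_poly_line_poly f n a h); rewrite ltnW.
by exists c => z; rewrite taylor_sumS.
Qed.

Lemma taylor_sum_along f n x (z : C) : (1 < n)%N ->
  taylor_sum f n (z *: x) = \sum_(j < n) z ^+ j *:
    (if (1 < j)%N then taylor_poly j f x else if j == 1 :> nat then x else 0).
Proof.
move=> n1; rewrite -(big_mkord xpredT (fun j => z ^+ j *:
  (if (1 < j)%N then taylor_poly j f x else if j == 1 :> nat then x else 0))).
rewrite [RHS](big_ltn (ltnW n1)) [X in _ = _ + X](big_ltn n1)/=.
rewrite scaler0 add0r; congr (_ + _).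
by apply: eq_big_nat => -[|[|j]]// _; rewrite taylor_poly_homog.
Qed.

Lemma cvgn_nrm (u : nat -> X) l e : u @ \oo --> l -> 0 < e ->
  exists n0, forall n, (n0 <= n)%N -> nrm (u n - l) <= e.
Proof.
move=> /cvgrPdist_le/(_ e%:C) ul e0; have [|n0 _ H] := ul; first by rewrite ltcR.
by exists n0 => n /H /=; rewrite nrm_le nrm_distC.
Qed.

Lemma series_tail (u : nat -> X) l (q B : R) n0 n : u @ \oo --> l -> 0 <= B ->
  0 <= q < 1 -> (forall m, (n0 <= m)%N -> nrm (u m.+1 - u m) <= B * q ^+ m) ->
  (n0 <= n)%N -> nrm (l - u n) <= B * (q ^+ n / (1 - q)).
Proof.
move=> ul B0 q01 uB n0n; apply: (@le_of_eps _ _ _ 1) => e e0; rewrite mulr1.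
have [m0 mP] := cvgn_nrm ul e0; pose m := maxn m0 n.
rewrite -(subrKA (u m)) (le_trans (nrmD _ _))// addrC lerD//; last first.
  by rewrite nrm_distC mP// leq_maxl.
rewrite -telescope_sumr ?leq_maxr// (le_trans (nrm_sum _ _ _))//.
apply: le_trans (ler_wpM2l B0 (geometric_tail n m q01)); rewrite mulr_sumr.
rewrite big_nat_cond [leRHS]big_nat_cond; apply: ler_sum => j.
by rewrite andbT => /andP[nj _]; apply: uB; exact: leq_trans nj.
Qed.


Lemma exp_le_eps (q e : R) n0 : 0 <= q < 1 -> 0 < e ->
  exists n, (n0 <= n)%N /\ q ^+ n <= e.
Proof.
move=> /andP[q0 q1] e0.
have /cvg_expr/cvgrPdist_le/(_ e e0)[m _ mP] : `|q| < 1 by rewrite ger0_norm.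
exists (maxn m n0); split; first exact: leq_maxr.
have := mP (maxn m n0) (leq_maxl _ _); rewrite /= sub0r normrN normrX ger0_norm//.
Qed.

Lemma holomorphic_near0_bounded f : holomorphic_near0 f ->
  exists2 r : R, 0 < r & exists M, forall x, nrm x < r -> nrm (f x) <= M.
Proof.
move=> /nbhs_singleton/differentiable_continuous/cvgrPdist_le/(_ 1 ltr01).
move=> /near0_nrmP[r r0 rP]; exists r => //; exists (1 + nrm (f 0)) => x /rP.
rewrite (_ : 1 = 1%:C)// nrm_le => H.
rewrite -(subrK (f 0) (f x)) (le_trans (nrmD _ _))// lerD2r nrm_distC//.
Qed.

(** * From the convergent Taylor series to the class [hol] and a fourth-order remainder *)

Section Expansion.
Variables (f : X -> X) (r M : R).
Hypotheses (r0 : 0 < r) (fM : forall x, nrm x < r -> nrm (f x) <= M).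
Hypothesis fE : forall x, nrm x < r -> taylor_sum f ^~ x @ \oo --> f x.

(* Cauchy's estimate on the circle |z| = 1, where the partial sums converge
   uniformly because the series still converges at a slightly larger radius. *)
Lemma taylor_poly_bound k x : (1 < k)%N -> nrm x < r ->
  nrm (taylor_poly k f x) <= M.
Proof.
move=> k1 xr; have x1 : 0 < nrm x + 1 by rewrite ltr_wpDl ?nrm_ge0.
(* Any factor [s > 1] with [s * nrm x < r] would do; the [+ 1] covers [x = 0]. *)
pose s := 1 + (r - nrm x) / (nrm x + 1).
have s1 : 1 < s by rewrite ltrDl divr_gt0// subr_gt0.
have s0 : 0 < s by apply: lt_trans s1.
have q01 : 0 <= s^-1 < 1 by rewrite invr_ge0 (ltW s0)/= invf_lt1.
have q1' : 0 < 1 - s^-1 by rewrite subr_gt0; case/andP: q01.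
have sx : nrm (s%:C *: x) < r.
  rewrite nrmZ nrmC ?(ltW s0)// /s mulrDl mul1r.
  rewrite -ltrBrDl mulrAC ltr_pdivrMr// ltr_pM2l ?subr_gt0//.
  by rewrite ltrDl.
have [n0 n0P] := cvgn_nrm (fE sx) (ltr01 : 0 < 1 :> R).
(* At [s *: x] consecutive partial sums are both within 1 of the limit, so a term is at most 2;
   homogeneity divides it by [s ^+ m]. *)
have tP m : (maxn n0 2 <= m)%N -> nrm (taylor_poly m f x) <= 2 * s^-1 ^+ m.
  rewrite geq_max => /andP[nm m2].
  have -> : x = (s^-1)%:C *: (s%:C *: x).
    by rewrite scalerA -rmorphM mulVf ?scale1r// gt_eqF.
  case: m m2 nm => // m m2 nm.
  rewrite taylor_poly_homog nrmZ nrmX nrmC ?invr_ge0 ?(ltW s0)//.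
  rewrite mulrC ler_wpM2r ?exprn_ge0 ?invr_ge0 ?(ltW s0)//.
  have := n0P _ nm; have := n0P _ (leqW nm).
  rewrite taylor_sumS// => H1 H2.
  rewrite -[taylor_poly _ _ _](addKr (taylor_sum f m.+1 (s%:C *: x))) addrC.
  rewrite -[leRHS]mulr1.
  by apply: (nrm_dist_approx (p := f (s%:C *: x))); rewrite nrm_distC.
apply: (@le_of_eps _ _ _ 1) => e e0; rewrite mulr1.
(* A large [n] makes the tail at most [e] and puts [k] among the coefficients of the partial sum. *)
have [|n [n0n nP]] := exp_le_eps (maxn (maxn n0 2) k.+1) q01
  (_ : 0 < e / 2 * (1 - s^-1)).
  by rewrite mulr_gt0// divr_gt0.
move: n0n; rewrite !geq_max => /andP[/andP[nn0 n2] nk].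
have n2' : (maxn n0 2 <= n)%N by rewrite geq_max nn0.
have SM (z : C) : nrm z = 1 -> nrm (taylor_sum f n (z *: x)) <= M + e.
  move=> z1; have zx : nrm (z *: x) < r by rewrite nrmZ z1 mul1r.
  have H : nrm (f (z *: x) - taylor_sum f n (z *: x)) <= 2 * (s^-1 ^+ n / (1 - s^-1)).
    apply: series_tail (fE zx) _ q01 _ n2' => // m mm.
    have m1 : (1 < m)%N by apply: leq_trans mm; rewrite leq_maxr.
    rewrite taylor_sumS// addrAC subrr add0r; case: m mm m1 => // m mm m1.
    by rewrite taylor_poly_homog nrmZ nrmX z1 expr1n mul1r tP.
  rewrite -(subKr (f (z *: x)) (taylor_sum f n (z *: x))) (le_trans (nrmB _ _))//.
  rewrite lerD ?fM// (le_trans H)// -ler_pdivlMl//.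
  by rewrite ler_pdivrMr// (mulrC 2^-1).
have n1 : (1 < n)%N by [].
pose c (j : nat) := if (1 < j)%N then taylor_poly j f x else if j == 1 then x else 0.
have := @coef_bound _ _ n _ c k 1 _ nk ler01 (fun z => taylor_sum_along f x z n1) SM.
by rewrite expr1n mul1r /c k1.
Qed.

Lemma taylor_poly_geometric k x (s : R) : (1 < k)%N -> 0 < s -> s * nrm x < r ->
  nrm (taylor_poly k f x) <= M * s^-1 ^+ k.
Proof.
move=> k1 s0 sx.
rewrite exprVn ler_pdivlMr ?exprn_gt0// mulrC -[X in X ^+ _](nrmC (ltW s0)).
case: k k1 => // k k1; rewrite -nrmX -nrmZ -taylor_poly_homog.
by apply: taylor_poly_bound => //; rewrite nrmZ nrmC// ltW.
Qed.

Lemma taylor_sum_tail n x (s : R) : (1 < n)%N -> 2 <= s -> s * nrm x < r ->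
  nrm (f x - taylor_sum f n x) <= M * (s^-1 ^+ n / (1 - s^-1)).
Proof.
move=> n1 s2 sx; have s0 : 0 < s by apply: lt_le_trans s2.
have M0 : 0 <= M by apply: le_trans (nrm_ge0 (f 0)) (fM _); rewrite nrm0.
have q01 : 0 <= s^-1 < 1.
  by rewrite invr_ge0 (ltW s0)/= invf_lt1// (lt_le_trans _ s2)// ltr1n.
have xr : nrm x < r.
  by apply: le_lt_trans sx; rewrite ler_peMl ?nrm_ge0// (le_trans _ s2)// ler1n.
apply: series_tail (fE xr) M0 q01 _ n1 => m m1.
by rewrite taylor_sumS// addrAC subrr add0r; exact: taylor_poly_geometric.
Qed.

(** On the half ball the scale [s = 2] is admissible, so the partial sums converge geometrically and
    uniformly; they are the approximants. *)
Lemma taylor_hol : hol (r / 2) M f.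
Proof.
split=> [x xr|e e0]; first by apply: fM; move: xr r0; lra.
have M0 : 0 <= M by apply: le_trans (nrm_ge0 (f 0)) (fM _); rewrite nrm0.
have q01 : 0 <= (2^-1 : R) < 1 by rewrite invr_ge0 ler0n/= invf_lt1// ltr1n.
have M1 : 0 < M + 1 by rewrite ltr_wpDl.
have [|n [n2 nP]] := exp_le_eps 2 q01 (_ : 0 < e / (M + 1) / 2).
  by rewrite !divr_gt0.
exists n.+2, (taylor_sum f n); split; first exact: taylor_sum_line_poly.
move=> x xr; rewrite nrm_distC (le_trans (taylor_sum_tail n2 (lexx 2) _))//.
  by rewrite mulrC -ltr_pdivlMr.
have -> : 1 - 2^-1 = 2^-1 :> R by lra.
rewrite invrK; move: nP; rewrite ler_pdivlMr// ler_pdivlMr// => nP.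
apply: le_trans nP; rewrite mulrC ler_wpM2l ?mulr_ge0 ?exprn_ge0 ?invr_ge0//.
by rewrite lerDl.
Qed.

Lemma taylor_cubic : exists K, forall x, nrm x < r / 4 ->
  nrm (f x - (x + taylor_poly 2 f x + taylor_poly 3 f x)) <= K * nrm x ^+ 4.
Proof.
have M0 : 0 <= M by apply: le_trans (nrm_ge0 (f 0)) (fM _); rewrite nrm0.
exists (2 * M * (2 / r) ^+ 4) => x xr.
have E : taylor_sum f 4 x = x + taylor_poly 2 f x + taylor_poly 3 f x.
  by rewrite /taylor_sum big_ltn// big_ltn// big_geq// addr0 addrA.
rewrite -E; have [->|x0] := eqVneq x 0.
  have q01 : 0 <= (0 : R) < 1 by rewrite lexx ltr01.
  have f0 : nrm (0 : X) < r by rewrite nrm0.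
  rewrite nrm0 expr0n mulr0 -(mul0r (0 ^+ 4 / (1 - 0))).
  apply: (series_tail (n0 := 4) (fE f0)) => // m m4.
  rewrite taylor_sumS; last exact: leq_trans m4.
  rewrite addrAC subrr add0r mul0r; case: m m4 => // m _.
  by rewrite -[in taylor_poly _ _ _](scale0r 0) taylor_poly_homog expr0n scale0r nrm0.
have nx : 0 < nrm x.
  by rewrite lt_neqAle nrm_ge0 andbT eq_sym; apply: contra_neq x0; exact: nrm0_eq0.
(* Scaling [x] up to norm [r / 2] turns the decay [s^-1 ^+ 4] into the required fourth power of
   [nrm x]. *)
pose s := r / 2 / nrm x.
have s2 : 2 <= s by rewrite /s ler_pdivlMr//; lra.
have sx : s * nrm x < r by rewrite /s divfK ?gt_eqF//; lra.
rewrite (le_trans (taylor_sum_tail _ s2 sx))//.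
have s0 : 0 < s by apply: lt_le_trans s2.
have sV : s^-1 = 2 / r * nrm x by rewrite /s; field; rewrite !gt_eqF.
have sV2 : s^-1 <= 2^-1 by rewrite lef_pV2 ?posrE.
rewrite (_ : 2 * M * _ * _ = M * (s^-1 ^+ 4 * 2)); last by rewrite sV; ring.
rewrite ler_wpM2l//.
rewrite ler_wpM2l ?exprn_ge0 ?invr_ge0 ?(ltW s0)//.
by rewrite -[leRHS]invrK lef_pV2 ?posrE ?invr_gt0//; lra.
Qed.

End Expansion.

Lemma normalized_expansion f : holomorphic_near0 f -> normalized_taylor_near0 f ->
  exists2 rho : R, 0 < rho & exists M K, hol rho M f /\
    forall x, nrm x < rho ->
      nrm (f x - (x + taylor_poly 2 f x + taylor_poly 3 f x)) <= K * nrm x ^+ 4.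
Proof.
move=> /holomorphic_near0_bounded[r r0 [M fM]] /near0_nrmP[r' r'0 fE].
pose m := Num.min r r'; have m0 : 0 < m by rewrite lt_min r0.
have fM' x : nrm x < m -> nrm (f x) <= M.
  by rewrite lt_min => /andP[xr _]; exact: fM.
have fE' x : nrm x < m -> taylor_sum f ^~ x @ \oo --> f x.
  by rewrite lt_min => /andP[_ xr]; exact: fE.
have [K KP] := taylor_cubic m0 fM' fE'.
exists (m / 4); first by rewrite divr_gt0.
exists M, K; split=> //; apply: hol_le (taylor_hol m0 fM' fE').
by lra.
Qed.

End TaylorSeries.

(** * Composition *)

Section BigO.
Context {R : realType} {X : completeNormedModType R[i]}.
Local Notation C := R[i].
Implicit Types (phi psi chi : C -> X) (x : X).

Definition bigO n phi := exists2 r : R, 0 < r &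
  exists K, forall z, nrm z <= r -> nrm (phi z) <= K * nrm z ^+ n.

Lemma bigO_prod m n phi psi chi (M : R) :
  (forall z, nrm (chi z) <= M * nrm (phi z) * nrm (psi z)) ->
  bigO m phi -> bigO n psi -> bigO (m + n) chi.
Proof.
move=> H [r r0 [K KP]] [s s0 [L LP]]; exists (Num.min r s); first by rewrite lt_min r0.
exists (`|M| * (`|K| * `|L|)) => z; rewrite le_min => /andP[zr zs].
apply: le_trans (H z) _; rewrite -mulrA.
have zn k : 0 <= nrm z ^+ k by rewrite exprn_ge0 ?nrm_ge0.
rewrite (le_trans (ler_wpM2r _ (ler_norm M))) ?mulr_ge0 ?nrm_ge0//.
rewrite -mulrA ler_wpM2l// exprD mulrACA ler_pM ?nrm_ge0//.
  by rewrite (le_trans (KP z zr))// ler_wpM2r// ler_norm.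
by rewrite (le_trans (LP z zs))// ler_wpM2r// ler_norm.
Qed.

Lemma bigOD n phi psi : bigO n phi -> bigO n psi -> bigO n (fun z => phi z + psi z).
Proof.
move=> [r r0 [K KP]] [s s0 [L LP]]; exists (Num.min r s); first by rewrite lt_min r0.
exists (K + L) => z; rewrite le_min => /andP[zr zs].
by rewrite mulrDl (le_trans (nrmD _ _))// lerD ?KP ?LP.
Qed.

Lemma bigO_expZ m x : bigO m (fun z => z ^+ m *: x).
Proof. by exists 1 => //; exists (nrm x) => z _; rewrite nrmZ nrmX mulrC. Qed.

Lemma bigO_exp n m phi : bigO n phi -> bigO (m + n) (fun z => z ^+ m *: phi z).
Proof.
move=> [r r0 [K KP]]; exists r => //; exists K => z zr.
by rewrite nrmZ nrmX exprD mulrCA ler_wpM2l ?KP// exprn_ge0// nrm_ge0.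
Qed.

Lemma bigOZ n k phi : bigO n phi -> bigO n (fun z => k *: phi z).
Proof.
move=> [r r0 [K KP]]; exists r => //; exists (nrm k * K) => z zr.
by rewrite nrmZ -mulrA ler_wpM2l ?nrm_ge0// KP.
Qed.

Lemma bigO_widen m n phi : (m <= n)%N -> bigO n phi -> bigO m phi.
Proof.
move=> mn [r r0 [K KP]]; exists (Num.min r 1); first by rewrite lt_min r0 ltr01.
exists `|K| => z; rewrite le_min => /andP[zr z1]; apply: le_trans (KP z zr) _.
rewrite (le_trans (ler_wpM2r _ (ler_norm K))) ?exprn_ge0 ?nrm_ge0//.
by rewrite ler_wpM2l// ler_wiXn2l// nrm_ge0.
Qed.

(** Cauchy's estimate on a circle of radius [s] gives the bound [|K| * s ^+ (n - k)] with a positive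
    exponent; let [s] tend to 0. *)
Lemma bigO_coef0 n (d : nat -> X) :
  bigO n (fun z => \sum_(k < n) z ^+ k *: d k) -> forall k, (k < n)%N -> d k = 0.
Proof.
move=> [r r0 [K KP]] k kn; apply/nrm0_eq0/eqP; rewrite eq_le nrm_ge0 andbT.
apply: (@le_of_eps _ _ _ `|K|) => e e0; rewrite add0r.
pose s := Num.min e (Num.min r 1).
have s0 : 0 < s by rewrite !lt_min e0 r0 ltr01.
have [se [sr s1]] : s <= e /\ s <= r /\ s <= 1.
  by rewrite /s !ge_min !lexx ?orbT.
have dM (z : C) : nrm z = s ->
    nrm (\sum_(k < n) z ^+ k *: d k) <= `|K| * s ^+ n.
  move=> zs; rewrite (le_trans (KP z _)) ?zs//.
  by rewrite ler_wpM2r ?exprn_ge0 ?(ltW s0)// ler_norm.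
have := coef_bound kn (ltW s0) (fun z => erefl) dM.
rewrite -(subnKC kn) addSnnS exprD mulrCA ler_pM2l ?exprn_gt0// => /le_trans; apply.
rewrite mulrC ler_wpM2r// exprS (le_trans _ se)//.
by rewrite ger_pMr// exprn_ile1// ltW.
Qed.

End BigO.

Section ChainRule.
Context {R : realType} {X : completeNormedModType R[i]}.
Local Notation C := R[i].
Implicit Types (f g : X -> X) (e u v w x y : X).

Lemma bounded_multilinear_nrm n (A : n.-tuple X -> X) : bounded_multilinear A ->
  exists K, forall v : n.-tuple X, nrm (A v) <= K * \prod_(i < n) nrm (tnth v i).
Proof.
move=> [_ [M MP]]; exists (complex.Re M) => v; have := MP v.
rewrite prod_nrm nrmE; case: M {MP} => a b.
by rewrite lecE/= => /andP[_]; rewrite mulr0 subr0.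
Qed.

Lemma multilinear2D (A : 2.-tuple X -> X) k u v w : multilinear A ->
  A [tuple u + k *: w; v] = A [tuple u; v] + k *: A [tuple w; v] /\
  A [tuple v; u + k *: w] = A [tuple v; u] + k *: A [tuple v; w].
Proof.
move=> Am; have E0 x : tuple_set ord0 [tuple 0; v] x = [tuple x; v].
  by apply: eq_from_tnth => -[[|[|//]] ?]; rewrite tnth_mktuple.
have E1 x : tuple_set ord_max [tuple v; 0] x = [tuple v; x].
  by apply: eq_from_tnth => -[[|[|//]] ?]; rewrite tnth_mktuple.
have := multilinear_setD ord0 [tuple 0; v] k u w Am.
have := multilinear_setD ord_max [tuple v; 0] k u w Am.
by rewrite !E0 !E1 => H0 H1; split.
Qed.

(** For [y = x + w] these telescope to [A(y,y,y) = A(x,x,x) + A(w,y,y) + A(x,w,y) + A(x,x,w)],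
    without appeal to symmetry. *)
Lemma multilinear3D (A : 3.-tuple X -> X) x y w : multilinear A ->
  [/\ A [tuple x + w; y; y] = A [tuple x; y; y] + A [tuple w; y; y],
   A [tuple x; x + w; y] = A [tuple x; x; y] + A [tuple x; w; y] &
   A [tuple x; x; x + w] = A [tuple x; x; x] + A [tuple x; x; w]].
Proof.
move=> Am; have D i (v : 3.-tuple X) : A (tuple_set i v (x + w)) =
    A (tuple_set i v x) + A (tuple_set i v w).
  by rewrite -[in LHS](scale1r w) multilinear_setD// scale1r.
have E0 u : tuple_set ord0 [tuple 0; y; y] u = [tuple u; y; y].
  by apply: eq_from_tnth => -[[|[|[|//]]] ?]; rewrite tnth_mktuple.
have E1 u : tuple_set (inord 1) [tuple x; 0; y] u = [tuple x; u; y].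
  by apply: eq_from_tnth => -[[|[|[|//]]] ?]; rewrite tnth_mktuple -val_eqE/= inordK.
have E2 u : tuple_set ord_max [tuple x; x; 0] u = [tuple x; x; u].
  by apply: eq_from_tnth => -[[|[|[|//]]] ?]; rewrite tnth_mktuple.
have := D ord0 [tuple 0; y; y]; have := D (inord 1) [tuple x; 0; y].
have := D ord_max [tuple x; x; 0].
by rewrite !E0 !E1 !E2 => H0 H1 H2; split.
Qed.

Lemma Dn2_bound f : exists M, forall u v,
  nrm (Dn (k := 2) f 0 [tuple u; v]) <= M * nrm u * nrm v.
Proof.
have [M MP] := bounded_multilinear_nrm (Dn_bounded_multilinear f 0 1).
exists M => u v; have := MP [tuple u; v].
by rewrite !big_ord_recl big_ord0 mulr1 mulrA.
Qed.

Lemma Dn3_bound f : exists M, forall u v w,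
  nrm (Dn (k := 3) f 0 [tuple u; v; w]) <= M * (nrm u * nrm v * nrm w).
Proof.
have [M MP] := bounded_multilinear_nrm (Dn_bounded_multilinear f 0 2).
exists M => u v w; have := MP [tuple u; v; w].
by rewrite !big_ord_recl big_ord0 mulr1 !mulrA.
Qed.

Lemma taylor_poly2E f x :
  taylor_poly 2 f x = 2^-1 *: Dn (k := 2) f 0 [tuple x; x].
Proof. by congr (_ *: Dn _ _ _); exact: val_inj. Qed.

Lemma taylor_poly3E f x :
  taylor_poly 3 f x = (3`!%:R)^-1 *: Dn (k := 3) f 0 [tuple x; x; x].
Proof. by congr (_ *: Dn _ _ _); exact: val_inj. Qed.

Lemma expansion_regroup (a b c d p q r s t : X) :
  a + (b + (c + r)) + (d + p + s) + (q + t) =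
  a + (d + b) + (q + c + p) + (r + (s + t)).
Proof. by rewrite !addrA [LHS](ACl (1*5*2*8*3*6*4*7*9))%AC. Qed.

Section Composition.
Variables (f g : X -> X) (rf rg Kf Kg Mf : R).
Hypotheses (rf0 : 0 < rf) (rg0 : 0 < rg) (fH : hol rf Mf f).
Hypothesis fE : forall x, nrm x < rf ->
  nrm (f x - (x + taylor_poly 2 f x + taylor_poly 3 f x)) <= Kf * nrm x ^+ 4.
Hypothesis gE : forall x, nrm x < rg ->
  nrm (g x - (x + taylor_poly 2 g x + taylor_poly 3 g x)) <= Kg * nrm x ^+ 4.

Lemma expansion_fix0 : g 0 = 0.
Proof.
have T n : taylor_poly n.+1 g 0 = 0.
  by rewrite -[in taylor_poly _ _ _](scale0r 0) taylor_poly_homog expr0n scale0r.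
have := gE (_ : nrm (0 : X) < rg).
rewrite nrm0 !T !addr0 subr0 expr0n mulr0 => /(_ rg0) H.
by apply/nrm0_eq0/eqP; rewrite eq_le H nrm_ge0.
Qed.

(** Write [g (z e) = y = z e + w] and [w = z^2 Q_2 + w'], where [w'] is of order 3. In [B(y, y) / 2]
    the cross term [z B(e, w)] contributes [z^3 B(e, Q_2)]; [z B(e, w')], [B(w, w)] and all cubic
    terms containing [w] are of order 4. *)
Lemma comp_expansion e : bigO 4 (fun z : C => f (g (z *: e)) - (z *: e +
  z ^+ 2 *: (taylor_poly 2 f e + taylor_poly 2 g e) +
  z ^+ 3 *: (taylor_poly 3 f e + taylor_poly 3 g e +
             Dn (k := 2) f 0 [tuple e; taylor_poly 2 g e]))).
Proof.
set Q2 := taylor_poly 2 g e; set Q3 := taylor_poly 3 g e.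
set B := fun u v => Dn (k := 2) f 0 [tuple u; v].
set T := fun u v w => Dn (k := 3) f 0 [tuple u; v; w].
have [Bm _] := Dn_bounded_multilinear f 0 1.
have [Tm _] := Dn_bounded_multilinear f 0 2.
have [MB BM] := Dn2_bound f; have [MT TM] := Dn3_bound f.
pose rho z := g (z *: e) - (z *: e + z ^+ 2 *: Q2 + z ^+ 3 *: Q3).
have rhoO : bigO 4 rho.
  have e1 : 0 < nrm e + 1 by rewrite ltr_wpDl ?nrm_ge0.
  exists (rg / 2 / (nrm e + 1)); first by rewrite !divr_gt0.
  exists (Kg * nrm e ^+ 4) => z; rewrite ler_pdivlMr// => zr.
  have ze : nrm (z *: e) < rg.
    rewrite nrmZ; have := nrm_ge0 z; move: zr rg0; rewrite mulrDr mulr1; lra.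
  by have := gE ze; rewrite !taylor_poly_homog nrmZ exprMn mulrCA mulrC.
pose w' z := z ^+ 3 *: Q3 + rho z.
pose w z := z ^+ 2 *: Q2 + w' z.
pose y z := z *: e + w z.
have yE z : g (z *: e) = y z by rewrite /y /w /w' /rho !addrA [RHS]addrC addKr.
have w'O : bigO 3 w'.
  by apply: bigOD; [exact: bigO_expZ|exact: bigO_widen rhoO].
have wO : bigO 2 w by apply: bigOD; [exact: bigO_expZ|exact: bigO_widen w'O].
have eO : bigO 1 (fun z => z *: e) by exact: (bigO_expZ 1 e).
have yO : bigO 1 y by apply: bigOD => //; exact: bigO_widen wO.
have fO : bigO 4 (fun z =>
    f (y z) - (y z + taylor_poly 2 f (y z) + taylor_poly 3 f (y z))).
  have [r r0 [K KP]] := yO; have K1 : 0 < `|K| + 1 by rewrite ltr_wpDl.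
  exists (Num.min r (rf / 2 / (`|K| + 1))); first by rewrite lt_min r0 !divr_gt0.
  exists (`|Kf| * `|K| ^+ 4) => z; rewrite le_min => /andP[zr].
  have yz : nrm (y z) <= `|K| * nrm z.
    by rewrite (le_trans (KP z zr))// expr1 ler_wpM2r ?nrm_ge0// ler_norm.
  rewrite ler_pdivlMr// => zK; have yr : nrm (y z) < rf.
    have := nrm_ge0 z; move: zK yz rf0; rewrite mulrDr mulr1 (mulrC (nrm z)).
    by move: (`|K| * _) => *; lra.
  rewrite (le_trans (fE yr))//.
  rewrite (le_trans (ler_wpM2r _ (ler_norm Kf))) ?exprn_ge0 ?nrm_ge0//.
  by rewrite -mulrA -exprMn ler_wpM2l// lerXn2r ?nnegrE ?mulr_ge0 ?nrm_ge0.
have BwO : bigO 4 (fun z => B (w z) (w z)) 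
  by exact: (bigO_prod (fun z => BM (w z) (w z)) wO wO).
have BeO : bigO 4 (fun z => z *: B e (w' z)).
  apply: (bigO_exp 1); apply: (bigO_prod (m := 0) (phi := fun=> e) _ _ w'O) => [z|].
    exact: BM.
  by exists 1 => //; exists (nrm e) => z _; rewrite expr0 mulr1.
have TO a b c p q r : bigO p a -> bigO q b -> bigO r c ->
    bigO (p + (q + r)) (fun z => T (a z) (b z) (c z)).
  move=> aO bO cO; have bcO : bigO (q + r) (fun z => (nrm (b z))%:C *: c z).
    apply: (bigO_prod (M := 1) _ bO cO) => z.
    by rewrite nrmZ nrmC ?nrm_ge0// mul1r.
  apply: (bigO_prod (M := MT) _ aO bcO) => z.
  by rewrite nrmZ nrmC ?nrm_ge0// mulrA -mulrA -mulrA (mulrA (nrm _)); exact: TM.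
have P2 z : taylor_poly 2 f (y z) = z ^+ 2 *: taylor_poly 2 f e + z ^+ 3 *: B e Q2
    + (z *: B e (w' z) + 2^-1 *: B (w z) (w z)).
  have BD k u v x : B (u + k *: v) x = B u x + k *: B v x.
    by have [H _] := multilinear2D k u x v Bm.
  have BC u v : B u v = B v u by exact: Dn2_sym fH rf0.
  have BDr k u v x : B x (u + k *: v) = B x u + k *: B x v by rewrite BC BD !(BC x).
  rewrite !taylor_poly2E -!/(B _ _).
  have E1 : B (y z) (y z) = B (w z) (w z) + z *: B e (w z) + (z *: B e (w z)
      + (z * z) *: B e e).
    rewrite /y (addrC (z *: e)) BD !BDr scalerDr scalerA (BC (w z) e).
    by rewrite addrA.
  have E2 : B e (w z) = B e (w' z) + z ^+ 2 *: B e Q2 by rewrite /w addrC BDr.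
  rewrite E1 E2; move: (B (w z) (w z)) (B e (w' z)) (B e Q2) (B e e) => b1 b2 b3 b4.
  (* Kept opaque, the two equal cross terms combine with coefficient [2^-1 + 2^-1 = 1]. *)
  have [q qE] : exists q, q = z *: (b2 + z ^+ 2 *: b3) by eexists.
  rewrite -qE.
  have half : 2^-1 + 2^-1 = 1 :> C by rewrite [RHS]splitr !mul1r.
  rewrite addrA -(addrA b1 q q) !scalerDr -scalerDl half scale1r qE scalerDr !scalerA.
  rewrite -exprS (_ : 2^-1 * (z * z) = z ^+ 2 * 2^-1) 1?mulrC// addrA.
  by rewrite [LHS](ACl (4*3*(2*1)))%AC.
pose R3 z := (3`!%:R)^-1 *: (T (w z) (y z) (y z) +
  (T (z *: e) (w z) (y z) + T (z *: e) (z *: e) (w z))).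
have P3 z : taylor_poly 3 f (y z) = z ^+ 3 *: taylor_poly 3 f e + R3 z.
  rewrite -taylor_poly_homog !taylor_poly3E /R3 -!/(T _ _ _) -scalerDr.
  congr (_ *: _); have [H1 H2 H3] := multilinear3D (z *: e) (y z) (w z) Tm.
  rewrite {1}/y /T H1 H2 H3 -/(T (w z) (y z) (y z)).
  by rewrite !addrA [LHS](ACl (1*4*3*2))%AC.
have R3O : bigO 4 R3.
  apply: bigOZ; apply: bigOD; first exact: (TO _ _ _ _ _ _ wO yO yO).
  apply: bigOD; first exact: (TO _ _ _ _ _ _ eO wO yO).
  exact: (TO _ _ _ _ _ _ eO eO wO).
have [r r0 [K KP]] := bigOD fO (bigOD rhoO (bigOD (bigOD BeO (bigOZ 2^-1 BwO)) R3O)).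
exists r => //; exists K => z zr; apply: le_trans (KP z zr).
rewrite le_eqVlt; apply/orP; left; apply/eqP; congr nrm.
rewrite yE P2 P3; set R2 := z *: B e (w' z) + _; set S := (X in _ - X).
have -> : y z + (z ^+ 2 *: taylor_poly 2 f e + z ^+ 3 *: B e Q2 + R2) +
    (z ^+ 3 *: taylor_poly 3 f e + R3 z) = S + (rho z + (R2 + R3 z)).
  by rewrite /S /y /w /w' !scalerDr; exact: expansion_regroup.
by clearbody S R2; rewrite opprD [X in _ = X + _]addrA subrK.
Qed.

End Composition.

End ChainRule.

(** * Taylor coefficients of the composite and the norm of the second derivative *)

Section SecondDerivative.
Context {R : realType} {X : completeNormedModType R[i]}.
Local Notation C := R[i].
Implicit Types (f g : X -> X) (e u v w x y : X).

(** A symmetric bilinear map is determined by its diagonal. This is needed because the functional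
    evaluates [D^2 (f o g)(0)] off the diagonal, at [[e, P_2 + Q_2]]. *)
Lemma polarization (f g h : X -> X) rf rg rh Mf Mg Mh u v :
  0 < rf -> hol rf Mf f -> 0 < rg -> hol rg Mg g -> 0 < rh -> hol rh Mh h ->
  (forall x, taylor_poly 2 h x = taylor_poly 2 f x + taylor_poly 2 g x) ->
  Dn (k := 2) h 0 [tuple u; v] =
  Dn (k := 2) f 0 [tuple u; v] + Dn (k := 2) g 0 [tuple u; v].
Proof.
move=> rf0 fH rg0 gH rh0 hH E.
have n2 : 2 != 0 :> C by [].
have E' x : Dn (k := 2) h 0 [tuple x; x] =
    Dn (k := 2) f 0 [tuple x; x] + Dn (k := 2) g 0 [tuple x; x].
  have := E x; rewrite !taylor_poly2E -scalerDr => /(congr1 (fun w => (2 : C) *: w)).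
  by rewrite !scalerA mulfV// !scale1r.
have Q (F : X -> X) r M : 0 < r -> hol r M F -> Dn (k := 2) F 0 [tuple u + v; u + v] =
    Dn (k := 2) F 0 [tuple u; u] + Dn (k := 2) F 0 [tuple v; v] +
    (2 : C) *: Dn (k := 2) F 0 [tuple u; v].
  move=> r0 FH; have [Fm _] := Dn_bounded_multilinear F 0 1.
  have D x y w : Dn (k := 2) F 0 [tuple x + y; w] =
      Dn (k := 2) F 0 [tuple x; w] + Dn (k := 2) F 0 [tuple y; w].
    by have [+ _] := multilinear2D 1 x w y Fm; rewrite !scale1r.
  rewrite D (Dn2_sym u (u + v) FH r0) (Dn2_sym v (u + v) FH r0) !D.
  rewrite (Dn2_sym v u FH r0) scaler_nat mulr2n.
  by rewrite !addrA [LHS](ACl (1*4*2*3))%AC.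
have := E' (u + v); rewrite (Q _ _ _ rh0 hH) (Q _ _ _ rf0 fH) (Q _ _ _ rg0 gH) !E'.
set a := Dn f 0 [tuple u; u]; set b := Dn g 0 [tuple u; u].
set c := Dn f 0 [tuple v; v]; set d := Dn g 0 [tuple v; v].
set p := Dn f 0 [tuple u; v]; set q := Dn g 0 [tuple u; v]; set t := Dn h 0 _.
move: a b c d p q t => a b c d p q t.
have -> : a + c + (2 : C) *: p + (b + d + (2 : C) *: q) =
    a + b + (c + d) + (2 : C) *: (p + q).
  by rewrite scalerDr !addrA [LHS](ACl (1*4*2*5*3*6))%AC.
by move=> /addrI; exact: scalerI.
Qed.

(** The Taylor expansion of [f (g (z e))] and the explicit one differ by [O(z^4)], so [bigO_coef0]
    equates their coefficients up to order 3. *)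
Lemma taylor_poly_comp f g rf rg Kf Kg Mf Mg :
  0 < rf -> 0 < rg -> hol rf Mf f -> hol rg Mg g ->
  (forall x, nrm x < rf ->
     nrm (f x - (x + taylor_poly 2 f x + taylor_poly 3 f x)) <= Kf * nrm x ^+ 4) ->
  (forall x, nrm x < rg ->
     nrm (g x - (x + taylor_poly 2 g x + taylor_poly 3 g x)) <= Kg * nrm x ^+ 4) ->
  [/\ exists2 rho, 0 < rho & hol rho Mf (f \o g),
   forall e, taylor_poly 2 (f \o g) e = taylor_poly 2 f e + taylor_poly 2 g e &
   forall e, taylor_poly 3 (f \o g) e = taylor_poly 3 f e + taylor_poly 3 g e +
     Dn (k := 2) f 0 [tuple e; taylor_poly 2 g e]].
Proof.
move=> rf0 rg0 fH gH fE gE.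
have [rho rho0 [FH _]] := hol_comp fH gH rf0 rg0 (expansion_fix0 rg0 gE).
pose t e k := taylor_poly k (f \o g) e.
pose d e (k : nat) := nth 0 [:: 0; e; taylor_poly 2 f e + taylor_poly 2 g e;
  taylor_poly 3 f e + taylor_poly 3 g e +
    Dn (k := 2) f 0 [tuple e; taylor_poly 2 g e]] k.
suff H e k : (k < 4)%N -> t e k = d e k.
  by split=> [|e|e]; [exists rho|exact: (H e 2%N)|exact: (H e 3%N)].
move=> k4; apply/esym/eqP; rewrite -subr_eq0; apply/eqP.
apply: (@bigO_coef0 _ _ 4 (fun k => d e k - t e k)) k4.
have [r r0 [K KP]] := hol_taylor e 4 FH rho0.
have TO : bigO 4 (fun z : C => (f \o g) (z *: e) - \sum_(k < 4) z ^+ k *: t e k).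
  exists r => //; exists K => z zr; apply: le_trans (KP z zr).
  rewrite le_eqVlt; apply/orP; left; apply/eqP; congr (nrm (_ - _)).
  by apply: eq_bigr => j _; rewrite /t (taylor_polyE _ _ FH rho0).
have := bigOD TO (bigOZ (-1) (comp_expansion rf0 rg0 fH fE gE e)).
move=> [s s0 [L LP]]; exists s => //; exists L => z zs; apply: le_trans (LP z zs).
rewrite le_eqVlt; apply/orP; left; apply/eqP; congr nrm.
rewrite scaleN1r opprB.
have -> : \sum_(k < 4) z ^+ k *: (d e k - t e k) =
    \sum_(k < 4) z ^+ k *: d e k - \sum_(k < 4) z ^+ k *: t e k.
  by rewrite -sumrB; apply: eq_bigr => j _; rewrite scalerBr.
move: (\sum_(k < 4) z ^+ k *: t e k) => T.
rewrite !big_ord_recl big_ord0 /d /bump /= scaler0 add0r addr0 expr1 !addrA.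
by rewrite [RHS](ACl (3*4*5*2*(1*6)))%AC/= subrr addr0.
Qed.

Lemma half_D2_normP f u v :
  nrm ((2^-1 : C) *: Dn (k := 2) f 0 [tuple u; v]) <= half_D2_norm f * nrm u * nrm v.
Proof.
pose A (v : 2.-tuple X) := (2^-1 : C) *: Dn (k := 2) f 0 v.
have [Am _] := Dn_bounded_multilinear f 0 1.
have [M MP] := Dn2_bound f.
have [u0|u0] := eqVneq (nrm u) 0.
  have := MP u v; rewrite u0 !mulr0 !mul0r => H.
  by rewrite nrmZ (le_trans (ler_wpM2l (nrm_ge0 _) H))// mulr0.
have [v0|v0] := eqVneq (nrm v) 0.
  have := MP u v; rewrite v0 !mulr0 => H.
  by rewrite nrmZ (le_trans (ler_wpM2l (nrm_ge0 _) H))// mulr0.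
have up : 0 < nrm u by rewrite lt_neqAle nrm_ge0 eq_sym u0.
have vp : 0 < nrm v by rewrite lt_neqAle nrm_ge0 eq_sym v0.
pose u' := (nrm u)^-1%:C *: u; pose v' := (nrm v)^-1%:C *: v.
have n1 (x : X) : nrm x != 0 -> nrm ((nrm x)^-1%:C *: x) = 1.
  by move=> x0; rewrite nrmZ nrmC ?invr_ge0 ?nrm_ge0// mulVf.
have ub : nrm (A [tuple u'; v']) <= half_D2_norm f.
  apply: ub_le_sup.
    (* [sup] dominates its set only if the set is bounded above; the absolute value is there because
       [M] may be negative. *)
    exists (nrm (2^-1 : C) * `|M|) => _ [w wP <-].
    rewrite -/(nrm _) nrmZ ler_wpM2l ?nrm_ge0//.
    have wE : w = [tuple tnth w ord0; tnth w ord_max].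
      by apply: eq_from_tnth => -[[|[|//]] ?]; congr (tnth w _); exact: val_inj.
    rewrite wE (le_trans (MP _ _))// -mulrA.
    have w0 := wP ord0; have w1 := wP ord_max.
    rewrite (_ : 1 = 1%:C)// nrm_le in w0; rewrite (_ : 1 = 1%:C)// nrm_le in w1.
    rewrite (le_trans (ler_wpM2r _ (ler_norm M))) ?mulr_ge0 ?nrm_ge0//.
    by rewrite ler_piMr// mulr_ile1 ?nrm_ge0.
  exists [tuple u'; v'] => //= -[[|[|//]] ?]; rewrite (_ : 1 = 1%:C)// nrm_le.
    by rewrite (tnth_nth 0)/= n1.
  by rewrite (tnth_nth 0)/= n1.
have scale k l x y : Dn (k := 2) f 0 [tuple k *: x; l *: y] =
    (k * l) *: Dn (k := 2) f 0 [tuple x; y].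
  have Z0 w : Dn (k := 2) f 0 [tuple 0; w] = 0.
    by apply/nrm0_eq0/eqP; rewrite eq_le nrm_ge0 (le_trans (MP _ _))// nrm0 mulr0 mul0r.
  have Z1 w : Dn (k := 2) f 0 [tuple w; 0] = 0.
    by apply/nrm0_eq0/eqP; rewrite eq_le nrm_ge0 (le_trans (MP _ _))// nrm0 mulr0.
  have [+ _] := multilinear2D k 0 (l *: y) x Am; rewrite !add0r Z0 add0r => ->.
  have [_ +] := multilinear2D l 0 x y Am; rewrite !add0r Z1 add0r => ->.
  by rewrite scalerA.
have uE : u = (nrm u)%:C *: u' by rewrite scalerA -rmorphM mulfV// scale1r.
have vE : v = (nrm v)%:C *: v' by rewrite scalerA -rmorphM mulfV// scale1r.
rewrite [in X in X <= _]uE [in X in X <= _]vE scale scalerA mulrC -scalerA nrmZ nrmM.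
rewrite !nrmC ?nrm_ge0// [leLHS]mulrC -[leRHS]mulrA.
by rewrite ler_wpM2r ?mulr_ge0 ?nrm_ge0.
Qed.

End SecondDerivative.

(** * The supporting functional and the final estimate *)

Section Duality.
Context {R : realType} {X : completeNormedModType R[i]}.
Local Notation C := R[i].

Lemma boundary_open_unit_ball (e : X) : boundary open_unit_ball e -> nrm e = 1.
Proof.
move=> [cl ni]; apply/eqP; rewrite eq_le; apply/andP; split; rewrite leNgt; apply/negP => e1.
  have [x [/= x1 xe]] : open_unit_ball `&` [set x | nrm (x - e) < nrm e - 1] !=set0.
    apply: cl; apply/nbhs0P/near0_nrmP; exists (nrm e - 1); first by rewrite subr_gt0.
    by move=> y ye /=; rewrite addrAC subrr add0r.
  move: x1; rewrite /open_unit_ball/= (_ : 1 = 1%:C)// nrm_lt => x1.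
  have := nrmB x (x - e); rewrite subKr; lra.
apply: ni; apply/nbhs0P/near0_nrmP; exists (1 - nrm e); first by rewrite subr_gt0.
move=> y ye; rewrite /open_unit_ball/= (_ : 1 = 1%:C)// nrm_lt.
by rewrite (le_lt_trans (nrmD _ _))//; lra.
Qed.

Lemma duality_set_bound (e x : X) (u : {linear X -> C^o}) : duality_set e u ->
  nrm (u x : C) <= nrm e * nrm x.
Proof.
move=> [uc ue _]; have uE k y : u (k *: y) = k * u y by rewrite linearZ.
have {ue}ue : dual_norm u = nrm e by apply: complexI; rewrite ue nrmE.
have [r r0 rP] : exists2 r : R, 0 < r & forall y, nrm y < r -> nrm (u y : C) <= 1.
  have /cvgrPdist_le/(_ 1 ltr01)/near0_nrmP[r r0 rP] := uc 0.
  exists r => // y /rP; rewrite linear0 sub0r normrN => H.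
  by rewrite -nrm_le.
have [->|x0] := eqVneq x 0; first by rewrite linear0 !nrm0 mulr0.
have nx : 0 < nrm x.
  by rewrite lt_neqAle nrm_ge0 andbT eq_sym; apply: contra_neq x0; exact: nrm0_eq0.
pose x' := (nrm x)^-1%:C *: x.
have nx' : nrm x' = 1 by rewrite nrmZ nrmC ?invr_ge0 ?nrm_ge0// mulVf// gt_eqF.
have : nrm (u x' : C) <= dual_norm u.
  apply: ub_le_sup.
    (* Boundedness of the set under [sup]: [u] is at most 1 on the ball of radius [r], which
       contains [r / 2] times the closed unit ball. *)
    exists (2 / r) => _ [w wP <-]; rewrite /= (_ : 1 = 1%:C)// nrm_le in wP.
    rewrite -/(nrm (u w : C)) ler_pdivlMr//.
    have := rP ((r / 2)%:C *: w); rewrite uE nrmM nrmZ nrmC ?divr_ge0 ?(ltW r0)// => H.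
    have H' : r / 2 * nrm w < r.
      by rewrite (le_lt_trans (ler_wpM2l _ wP)) ?divr_ge0 ?(ltW r0)//; lra.
    by have := H H'; move: (nrm (u w : C)) => q; nra.
  by exists x' => //=; rewrite (_ : 1 = 1%:C)// nrm_le nx'.
rewrite ue uE nrmM nrmC ?invr_ge0 ?nrm_ge0// mulrC ler_pdivrMr//.
Qed.

End Duality.

Section Remainder.
Context {R : realType} {X : completeNormedModType R[i]}.
Implicit Types (b c p q : X) (mu L s t : R[i]).

(** [b], [b'] stand for [D^2 f(0)] at [[e, Q_2]], [[e, P_2]], and [c], [c'] for [D^2 g(0)] at
    [[e, P_2]], [[e, Q_2]]. Terms belonging to one map alone cancel. *)
Lemma remainder_identity (P Q : X) b b' c c' p q mu L s t :
  P + Q + b - (mu / 2) *: (b' + b + (c + c')) - (L * (s + t)) *: (p + q)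
    - (P - (mu / 2) *: b' - (L * s) *: p + (Q - (mu / 2) *: c' - (L * t) *: q)) =
  - ((mu - 2) *: (2^-1 *: b) + mu *: (2^-1 *: c) + (L * s) *: q + (L * t) *: p).
Proof.
have -> : (mu - 2) *: (2^-1 *: b) = (mu / 2) *: b - b.
  by rewrite scalerA mulrBl scalerBl mulfV ?pnatr_eq0// scale1r.
rewrite (scalerA mu) mulrDr scalerDl !scalerDr !opprD !opprK !addrA.
rewrite [LHS](ACl (5*3*6*9*10*(1*12)*(2*15)*(4*13)*(7*16)*(8*14)*(11*17)))%AC/=.
by rewrite !subrr !addNr !addr0.
Qed.

(** Here [b] and [c] already contain the factor 1/2. Each summand is at most [N * M] times the
    modulus of its coefficient; the two pairing terms share [L]. *)
Lemma remainder_bound b c p q mu L s t (N M : R) :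
  nrm b <= N * nrm q -> nrm c <= M * nrm p -> nrm s <= nrm p -> nrm t <= nrm q ->
  nrm p <= N -> nrm q <= M ->
  nrm ((mu - 2) *: b + mu *: c + (L * s) *: q + (L * t) *: p) <=
  (2 * nrm L + nrm mu + nrm (mu - 2)) * N * M.
Proof.
move=> bq cp sp tq pN qM.
have N0 : 0 <= N by apply: le_trans pN; exact: nrm_ge0.
have M0 : 0 <= M by apply: le_trans qM; exact: nrm_ge0.
apply: (@le_trans _ _ (nrm (mu - 2) * (N * M) + nrm mu * (N * M)
  + nrm L * (N * M) + nrm L * (N * M))); last first.
  by rewrite le_eqVlt; apply/orP; left; apply/eqP; ring.
apply: le_trans (nrmD _ _) _; apply: lerD.
  apply: le_trans (nrmD _ _) _; apply: lerD.
    apply: le_trans (nrmD _ _) _.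
    apply: lerD; rewrite nrmZ; apply: ler_wpM2l; rewrite ?nrm_ge0//.
      by apply: le_trans bq _; exact: ler_wpM2l.
    by apply: le_trans cp _; rewrite (mulrC N); exact: ler_wpM2l.
  rewrite nrmZ nrmM -mulrA; apply: ler_wpM2l; rewrite ?nrm_ge0//.
  by apply: ler_pM; rewrite ?nrm_ge0//; exact: le_trans pN.
rewrite nrmZ nrmM -mulrA; apply: ler_wpM2l; rewrite ?nrm_ge0// (mulrC N).
by apply: ler_pM; rewrite ?nrm_ge0//; exact: le_trans qM.
Qed.

End Remainder.

Theorem theorem4p3 (R : realType) (X : completeNormedModType R[i])
    (lambda mu : R[i]) (e : X) (estar : {linear X -> R[i]^o}) (f g : X -> X) :
  boundary open_unit_ball e ->
  duality_set e estar ->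
  holomorphic_near0 f -> normalized_taylor_near0 f ->
  holomorphic_near0 g -> normalized_taylor_near0 g ->
  let Psi h := fekete_szego e estar h lambda mu in
  let Rfg := Psi (f \o g) - (Psi f + Psi g) in
  let ell := 2 * `|lambda - mu| + `|mu| + `|mu - 2| in
  `|Rfg| <= ell * (half_D2_norm f)%:C * (half_D2_norm g)%:C.
Proof.
move=> /boundary_open_unit_ball e1 du hf nf hg ng.
pose Psi h := fekete_szego e estar h lambda mu.
pose Rfg := Psi (f \o g) - (Psi f + Psi g).
pose ell := 2 * `|lambda - mu| + `|mu| + `|mu - 2|.
change (`|Rfg| <= ell * (half_D2_norm f)%:C * (half_D2_norm g)%:C).
have [rf rf0 [Mf [Kf [fH fE]]]] := normalized_expansion hf nf.
have [rg rg0 [Mg [Kg [gH gE]]]] := normalized_expansion hg ng.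
have [[rh rh0 hH] P2 P3] := taylor_poly_comp rf0 rg0 fH gH fE gE.
have B2 u v := polarization u v rf0 fH rg0 gH rh0 hH P2.
set p := taylor_poly 2 f e; set q := taylor_poly 2 g e.
have D (h : X -> X) u v w : Dn (k := 2) h 0 [tuple u; v + w] =
    Dn (k := 2) h 0 [tuple u; v] + Dn (k := 2) h 0 [tuple u; w].
  have [hm _] := Dn_bounded_multilinear h 0 1.
  by have [_ +] := multilinear2D 1 v u w hm; rewrite !scale1r.
have key : Rfg = - ((mu - 2) *: (2^-1 *: Dn (k := 2) f 0 [tuple e; q])
    + mu *: (2^-1 *: Dn (k := 2) g 0 [tuple e; p])
    + ((lambda - mu) * estar p) *: q + ((lambda - mu) * estar q) *: p).
  rewrite /Rfg /Psi /fekete_szego P3 B2 P2 -/p -/q !D (linearD estar).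
  exact: remainder_identity.
(* [P_2(e)] is half the second derivative at [[e, e]], and [e] has norm 1. *)
have pN : nrm p <= half_D2_norm f.
  by have := half_D2_normP f e e; rewrite -taylor_poly2E e1 !mulr1.
have qN : nrm q <= half_D2_norm g.
  by have := half_D2_normP g e e; rewrite -taylor_poly2E e1 !mulr1.
have sN : nrm (estar p : R[i]) <= nrm p.
  by have := duality_set_bound p du; rewrite e1 mul1r.
have tN : nrm (estar q : R[i]) <= nrm q.
  by have := duality_set_bound q du; rewrite e1 mul1r.
have fq := half_D2_normP f e q; have gp := half_D2_normP g e p.
rewrite e1 mulr1 in fq; rewrite e1 mulr1 in gp.
have -> : ell = (2 * nrm (lambda - mu) + nrm mu + nrm (mu - 2))%:C.
  by rewrite /ell !rmorphD rmorphM rmorph_nat /= -!nrmE.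
rewrite -!rmorphM nrm_le key nrmN.
exact: (remainder_bound mu (lambda - mu) fq gp sN tN pN qN).
Qed.
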